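(* Consider a $(\{b_n\},\{A\},0)$-Sequence, where $A_n=A\subseteq\{0,1,\dots,b\}$ for every $n$, with $b\le\min_n b_n$. Let $\{Y_n\}$ be the sequence of independent random variables representing the number of summands chosen from each bin; thus, if the largest summand of the decomposition of an integer $x$ is from bin $N$, then the total number of summands in this decomposition is $Y_1(x)+\cdots+Y_N(x)$. Let $m=\max(A)$ and $m'=\max(A\setminus\{m\})$. If the growth of $\{b_n\}$ is slower than $n^{1/(m-m')}$, i.e. $b_n=o\bigl(n^{1/(m-m')}\bigr)$ as $n\to\infty$, then the distribution of the number of summands of integers whose largest summand is in bin $N$ converges to a Gaussian distribution in the sense of Lyapunov as $N\to\infty$.
   Context: Let $(b_n)_{n\ge1}$ be a sequence of positive integers and let $A$ be a set of integers with $\{0,1\}\subseteq A\subseteq\{0,1,\dots,b\}$. The $(\{b_n\},\{A\},0)$-Sequence is a sequence of positive integers arranged consecutively in bins: the first $b_1$ terms form bin 1, the next $b_2$ terms form bin 2, and so on. A legal decomposition of an integer $x$ is an expression of $x$ as the sum of finitely many chosen terms such that, for every $n$, the number of terms chosen from bin $n$ belongs to $A$; the $0$ in the notation means there is no adjacency restriction between different bins. The sequence is constructed recursively: the first term is $1$, and once the first $k$ terms have been constructed, the next term (filling the bins in order) is the least positive integer with no legal decomposition using the first $k$ terms. The setting is that of sequences for which every positive integer has a unique legal decomposition, so that one may speak of ''the decomposition'' and ''the summands'' of an integer $x$; $Y_n(x)$ denotes the number of terms of bin $n$ in the decomposition of $x$. For each $N$, the distribution in question is that of $Y_1(x)+\cdots+Y_N(x)$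 when $x$ is chosen uniformly at random among the integers whose largest summand is in bin $N$. Write $\mu_n=\mathbb{E}[Y_n]$ and $s_N^2=\sum_{n=1}^N\mathrm{Var}(Y_n)$. Convergence to a Gaussian in the sense of Lyapunov means that the Lyapunov condition holds, i.e. there is $\delta>0$ with $$\lim_{N\to\infty}\frac{1}{s_N^{2+\delta}}\sum_{n=1}^N\mathbb{E}\bigl[|Y_n-\mu_n|^{2+\delta}\bigr]=0,$$ so that $\frac1{s_N}\sum_{n=1}^N(Y_n-\mu_n)$ converges in distribution to the standard normal as $N\to\infty$. *)

(* Defs.v *)
From HB Require Import structures.
From mathcomp Require Export all_boot all_order all_algebra finmap.
From mathcomp Require Export all_classical all_reals all_analysis.
Export Order.TTheory GRing.Theory Num.Theory numFieldNormedType.Exports.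

Set Implicit Arguments.
Unset Strict Implicit.
Unset Printing Implicit Defensive.

Local Open Scope classical_set_scope.
Local Open Scope fset_scope.
Local Open Scope ring_scope.

(* Bins are numbered from 1 and terms from 0: bin n consists of the terms of
   index bin_end bs n.-1, ..., (bin_end bs n).-1, so that bin 0 is empty and the
   value bs 0 is never used. *)
Section BinSequence.
Variables (bs : nat -> nat) (A : {fset nat}) (a : nat -> nat).

Definition bin_end (n : nat) : nat := (\sum_(1 <= k < n.+1) bs k)%N.

Definition in_bin (n i : nat) : bool := (bin_end n.-1 <= i < bin_end n)%N.

(* The number of terms of bin n among the terms whose indices are in D. *)
Definition bin_count (n : nat) (D : {fset nat}) : nat :=
  #|` [fset i in D | in_bin n i]|.

Definition legal_decomposition (x : nat) (D : {fset nat}) : Prop :=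
  (\sum_(i <- D) a i)%N = x /\ forall n, bin_count n D \in A.

Definition legal_with_first (k x : nat) : Prop :=
  exists2 D, legal_decomposition x D & forall i, i \in D -> (i < k)%N.

Definition bin_sequence : Prop :=
  a 0%N = 1%N /\
  forall k, (0 < k)%N ->
    [/\ (0 < a k)%N,
        ~ legal_with_first k (a k) &
        forall y, (0 < y)%N -> ~ legal_with_first k y -> (a k <= y)%N].

Definition unique_decompositions : Prop :=
  forall x, (0 < x)%N -> exists! D, legal_decomposition x D.

(* The decomposition of x; meaningful under unique_decompositions. *)
Definition decomposition (x : nat) : {fset nat} :=
  xget fset0 [set D | legal_decomposition x D].

Definition Y (n x : nat) : nat := bin_count n (decomposition x).

(* The integers whose largest summand is in bin N.  The terms of a bin sequence
   are strictly increasing, so only the terms of the first N bins occur in the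
   decompositions of these integers, and this set is finite. *)
Definition largest_in_bin (N : nat) : set nat :=
  [set x | exists2 i, i \in decomposition x &
     in_bin N i /\ forall j, j \in decomposition x -> (a j <= a i)%N].

Variable R : realType.

Definition expect (N : nat) (f : nat -> R) : R :=
  (\sum_(x <- fset_set (largest_in_bin N)) f x) /
  #|` fset_set (largest_in_bin N)|%:R.

Definition prob (N : nat) (E : set nat) : R := expect N \1_E.

Definition mean (N n : nat) : R := expect N (fun x => (Y n x)%:R).

Definition var (N n : nat) : R :=
  expect N (fun x => ((Y n x)%:R - mean N n) ^+ 2).

Definition stddev (N : nat) : R := Num.sqrt (\sum_(1 <= n < N.+1) var N n).

Definition independent_counts (N : nat) : Prop :=
  forall (J : {fset nat}) (k : nat -> nat),
    (forall n, n \in J -> (1 <= n <= N)%N) ->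
    prob N [set x | forall n, n \in J -> Y n x = k n] =
    \prod_(n <- J) prob N [set x | Y n x = k n].

Definition lyapunov_condition : Prop :=
  exists2 delta : R, 0 < delta &
    (\sum_(1 <= n < N.+1)
        expect N (fun x => `|(Y n x)%:R - mean N n| `^ (2 + delta)))
      / stddev N `^ (2 + delta) @[N --> \oo] --> (0 : R).

Definition normalized_sum (N x : nat) : R :=
  (stddev N)^-1 * \sum_(1 <= n < N.+1) ((Y n x)%:R - mean N n).

Definition converges_to_std_normal : Prop :=
  forall t : R,
    (prob N [set x | normalized_sum N x <= t])%:E @[N --> \oo]
      --> normal_prob 0 1 `]-oo, t].

Definition lyapunov_gaussian : Prop :=
  [/\ forall N, (1 <= N)%N -> independent_counts N,
      lyapunov_condition & converges_to_std_normal].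

End BinSequence.

Definition max_elt (A : {fset nat}) : nat := (\max_(k <- A) k)%N.

(* Main.v *)
From HB Require Import structures.
Require Import Defs.
From mathcomp Require Import measurable_realfun zify ring lra.

(** By uniqueness of decompositions, the integers whose largest summand is in bin
    [N] correspond to the sets of indices of the first [N] bins whose trace on
    every bin has a size in [A], and a nonzero size on bin [N].  Exchanging the
    traces of two such sets on one bin is an involution of the pairs of sets,
    hence the counts [Y_n] are independent, and [Y_n = k] has a probability
    proportional to ['C(b_n, k)] for [n < N].  The values [m] and [m'] then give
    [Var Y_n >= c / b_n ^ (m - m') >= c / n] eventually, so that [s_N -> oo] by
    divergence of the harmonic series.  As the counts are bounded by [m], this is
    the Lyapunov condition with [delta = 1].

    The central limit theorem is obtained by Stein's method: for a Lipschitz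
    approximation [h] of the indicator of [x <= t], with Gaussian mean [c], the
    equation [f' w - w f w = h w - c] has a solution with Lipschitz derivative,
    and [E (f' W - W f W)] is [O(m / s_N)] for a normalized sum [W] of independent
    centered variables bounded by [m / s_N]. *)

Set Implicit Arguments.
Unset Strict Implicit.
Unset Printing Implicit Defensive.

Local Open Scope ring_scope.

(** * Families of sets with prescribed traces *)

Section BlockFamilies.
Variables (T : finType) (N : nat) (B : nat -> {set T}) (P : nat -> pred nat).
Hypothesis B_disj : forall n k, n != k -> B n :&: B k = finset.set0.

(** Abstract form of the legal index sets: the blocks become the bins, and [P n] becomes membership
    in [A], with 0 excluded in the last bin. *)
Definition block_family : {set {set T}} :=
  [set D : {set T} | [forall n : 'I_N.+1, P n #|D :&: B n|]].
Local Notation L := block_family.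

Lemma block_familyP (D : {set T}) :
  reflect (forall n, (n <= N)%N -> P n #|D :&: B n|) (D \in L).
Proof.
rewrite inE; apply: (iffP forallP) => [H n nN|H n].
  exact: (H (Ordinal (nN : (n < N.+1)%N))).
by apply: H; rewrite -ltnS.
Qed.

Definition splice n (D S : {set T}) : {set T} := (D :\: B n) :|: (S :&: B n).

Lemma spliceI n D S : splice n D S :&: B n = S :&: B n.
Proof.
by apply/setP => x; rewrite !inE; case: (x \in B n); rewrite ?andbT ?andbF.
Qed.

Lemma spliceD n D S : splice n D S :\: B n = D :\: B n.
Proof.
by apply/setP => x; rewrite !inE; case: (x \in B n);
   rewrite ?andbT ?andbF ?orbF.
Qed.

Lemma spliceI_neq n k D S : n != k -> splice n D S :&: B k = D :&: B k.
Proof.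
move=> nk; apply/setP => x; rewrite !inE.
have := B_disj nk; move=> /setP /(_ x); rewrite !inE.
by case: (x \in B n); case: (x \in B k); rewrite ?andbT ?andbF ?orbF.
Qed.

Lemma splice_family n D S : (n <= N)%N -> P n #|S :&: B n| -> D \in L ->
  splice n D S \in L.
Proof.
move=> nN PS /block_familyP DL; apply/block_familyP => k kN.
by have [<-|nk] := eqVneq n k; rewrite ?spliceI // spliceI_neq // DL.
Qed.

Lemma splice_twice n D S S' : splice n (splice n D S) S' = splice n D S'.
Proof.
by apply/setP => x; rewrite !inE; case: (x \in B n);
   rewrite ?andbT ?andbF ?orbF.
Qed.

Lemma splice_self n D S : D :&: B n = S :&: B n -> splice n D S = D.
Proof.
by move=> /setP e; apply/setP => x; move: (e x); rewrite !inE;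
   case: (x \in B n); rewrite ?andbT ?andbF ?orbF //= => ->.
Qed.

(* Exchanging the traces on [B n] of two members of the family is an involution
   of the pairs of members. *)
Lemma block_family_indep (R : comNzRingType) n (u v : {set T} -> R) : (n <= N)%N ->
  #|L|%:R * (\sum_(D in L) u (D :&: B n) * v (D :\: B n)) =
  (\sum_(D in L) u (D :&: B n)) * (\sum_(D in L) v (D :\: B n)).
Proof.
move=> nN.
pose tau (p : {set T} * {set T}) := (splice n p.1 p.2, splice n p.2 p.1).
have tauK : involutive tau.
  case=> D S; rewrite /tau /=; congr pair; rewrite splice_twice splice_self //;
  by rewrite spliceI.
pose Q (p : {set T} * {set T}) := (p.1 \in L) && (p.2 \in L).
have Qtau p : Q (tau p) = Q p.
  have H q : Q q -> Q (tau q).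
    move=> /andP[/= D1 D2]; apply/andP.
    by split; apply: splice_family => //;
      [move/block_familyP: D2|move/block_familyP: D1]; apply.
  by apply/idP/idP => [/H|/H //]; rewrite tauK.
transitivity (\sum_(p | Q p) u (p.1 :&: B n) * v (p.1 :\: B n)).
  rewrite -(pair_big (mem L) (mem L) (fun D S => u (D :&: B n) * v (D :\: B n))) /=.
  rewrite big_distrr /=; apply: eq_bigr => D _.
  by rewrite sumr_const mulr_natl.
(* After the exchange, [u] sees only the second member of the pair and [v] only the first, so the
   double sum factors. *)
rewrite (reindex_inj (inv_inj tauK)) (eq_bigl _ _ Qtau).
under eq_bigr do rewrite /= spliceI spliceD.
rewrite -(pair_big (mem L) (mem L) (fun D S => u (S :&: B n) * v (D :\: B n))) /=.
rewrite exchange_big big_distrl /=; apply: eq_bigr => D _.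
by rewrite big_distrr.
Qed.

Definition free_family n : {set {set T}} := [set D in L | D :&: B n == finset.set0].

(** Filling block [n] with [S] and emptying it are inverse bijections; emptying stays in the family
    because [P n 0] holds. *)
Lemma card_trace n (S : {set T}) : (n <= N)%N -> P n 0%N -> S \subset B n ->
  P n #|S| -> #|[set D in L | D :&: B n == S]| = #|free_family n|.
Proof.
move=> nN P0 SB PS.
have SBe : S :&: B n = S by apply/finset.setIidPl.
have <- : [set splice n D S | D in free_family n] = [set D in L | D :&: B n == S].
  apply/setP => D; rewrite inE; apply/imsetP/andP => [[D']|[DL /eqP DS]].
    rewrite inE => /andP[D'L _] ->.
    by rewrite splice_family ?SBe // spliceI SBe.
  exists (splice n D finset.set0).
    by rewrite inE spliceI finset.set0I splice_family ?finset.set0I ?cards0 /=.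
  by rewrite splice_twice splice_self // SBe.
apply: card_in_imset => D D'; rewrite !inE => /andP[_ /eqP D0] /andP[_ /eqP D'0] e.
have := congr1 (fun X => X :\: B n) e; rewrite !spliceD => {}e.
by rewrite -(finset.setID D (B n)) -(finset.setID D' (B n)) D0 D'0 e.
Qed.

(** Group the members by their trace on [B n]: each of the [k]-subsets of [B n] occurs equally
    often, by [card_trace]. *)
Lemma card_trace_size n k : (n <= N)%N -> P n 0%N -> P n k ->
  #|[set D in L | #|D :&: B n| == k]| = (#|free_family n| * 'C(#|B n|, k))%N.
Proof.
move=> nN P0 Pk.
rewrite -sum1_card (partition_big (fun D => D :&: B n)
  (mem [set S : {set T} | S \subset B n & #|S| == k])) /=; last first.
  by move=> D; rewrite !inE => /andP[_ ->]; rewrite finset.subsetIr.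
rewrite mulnC -cards_draws -sum_nat_const; apply: eq_bigr => S.
rewrite inE => /andP[SB /eqP Sk].
rewrite -(card_trace nN P0 SB) ?Sk // -sum1_card; apply: eq_bigl => D.
rewrite !inE -andbA; congr (_ && _).
by case: (D :&: B n =P S) => [->|_]; rewrite ?andbF // Sk eqxx.
Qed.

End BlockFamilies.

Local Open Scope classical_set_scope.
Local Open Scope fset_scope.
Local Open Scope ring_scope.

(** * Stein's equation *)

Section Calculus.
Variable R : realType.
Implicit Types (f g : R -> R) (x y : R).

Lemma is_derive1M f g x a b : is_derive x 1 f a -> is_derive x 1 g b ->
  is_derive x (1 : R) (fun y => f y * g y) (a * g x + f x * b).
Proof.
move=> fa gb; apply: (@is_derive_eq _ _ _ _ _ _ _ _ (is_deriveM fa gb)).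
by rewrite /GRing.scale /= addrC [g x * a]mulrC.
Qed.

Lemma is_derive1B f g x a b : is_derive x 1 f a -> is_derive x 1 g b ->
  is_derive x (1 : R) (fun y => f y - g y) (a - b).
Proof. by move=> fa gb; exact: is_deriveB. Qed.

Lemma is_derive1V f x a : f x != 0 -> is_derive x 1 f a ->
  is_derive x (1 : R) (fun y => (f y)^-1) (- (a / f x ^+ 2)).
Proof.
move=> fx0 fa; apply: (@is_derive_eq _ _ _ _ _ _ _ _ (is_deriveV fx0 fa)).
by rewrite /GRing.scale /= mulNr mulrC.
Qed.

Lemma is_derive_continuous f x a : is_derive x (1 : R) f a ->
  {for x, continuous f}.
Proof. by move=> [/derivable1_diffP /differentiable_continuous]. Qed.

Lemma is_derive_within_continuous f df (A : set R) :
  (forall x, A x -> is_derive x (1 : R) f (df x)) ->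
  {within A, continuous f}.
Proof.
move=> fdf; apply: continuous_in_subspaceT => x /set_mem /fdf.
exact: is_derive_continuous.
Qed.

(** The two points may come in either order; the bound on [z] serves to estimate a Taylor remainder
    in [stein_bound]. *)
Lemma MVT_between f df x y : (forall z, is_derive z (1 : R) f (df z)) ->
  exists2 z, f y - f x = df z * (y - x) & `|z - x| <= `|y - x|.
Proof.
move=> fdf.
have W a b : {within `[a, b], continuous f}.
  exact: (is_derive_within_continuous (fun x _ => fdf x)).
have [xy|yx] := leP x y.
  have [z zxy e] := MVT_segment xy (fun z _ => fdf z) (W _ _).
  exists z => //; move: zxy; rewrite in_itv /= => /andP[xz zy].
  by rewrite !ger0_norm ?subr_ge0 //; lra.
have [z zxy e] := MVT_segment (ltW yx) (fun z _ => fdf z) (W _ _).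
exists z; first by lra.
move: zxy; rewrite in_itv /= => /andP[xz zy].
by rewrite !ler0_norm ?subr_le0 //; lra.
Qed.

(** A nondecreasing function stays below its limit: if [f w] were positive, some later value would
    be smaller than [f w], against the mean value theorem. *)
Lemma le0_of_increasing_cvg0 f df (M : R) :
  (forall x, M <= x -> is_derive x (1 : R) f (df x)) ->
  (forall x, M <= x -> 0 <= df x) -> f x @[x --> +oo] --> (0 : R) ->
  forall w, M <= w -> f w <= 0.
Proof.
move=> fdf df0 f0 w Mw; rewrite leNgt; apply/negP => fw.
have {}f0 : \forall x \near +oo, f x < f w by exact: cvgr_lt f0 _ fw.
near +oo_R => y.
have wy : w <= y by near: y; apply: nbhs_pinfty_ge; exact: num_real.
have fy : f y < f w by near: y.
have [z||z zwy e] := @MVT_segment _ f df w y wy.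
- by rewrite in_itv /= => /andP[wz _]; apply: fdf; lra.
- apply: (@is_derive_within_continuous _ df) => z /=.
  by rewrite in_itv /= => /andP[wz _]; apply: fdf; lra.
move: zwy; rewrite in_itv /= => /andP[wz _].
have : 0 <= df z * (y - w) by rewrite mulr_ge0 ?subr_ge0 // df0 //; lra.
lra.
Unshelve. all: by end_near. Qed.

Lemma continuous_bounded_itv f (a b : R) : continuous f ->
  exists2 K, 0 <= K & forall x, a <= x <= b -> `|f x| <= K.
Proof.
move=> cf; have [ab|ba] := leP a b; last first.
  by exists 0 => // x /andP[ax xb]; lra.
have cnf : {within `[a, b], continuous (fun x => `|f x|)}.
  by apply: continuous_subspaceT => x; apply: cvg_norm; exact: cf.
have [c _ cmax] := EVT_max ab cnf.
exists `|f c| => // x xab; apply: cmax; by rewrite in_itv.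
Qed.

End Calculus.

(** * Tail estimates for the standard normal density *)

Section GaussianTails.
Variable R : realType.
Local Notation phi := (@normal_pdf R 0 1).
Implicit Types (w x c M : R).

Lemma std_normal_pdfE x : phi x = normal_peak 1 * expR (- (x ^+ 2) / 2).
Proof. by rewrite normal_pdfE ?oner_eq0 // /normal_fun subr0 expr1n. Qed.

Lemma std_normal_pdf_gt0 x : 0 < phi x.
Proof. by rewrite std_normal_pdfE mulr_gt0 ?expR_gt0 ?normal_peak_gt0 ?oner_eq0. Qed.

Lemma std_normal_pdfN x : phi (- x) = phi x.
Proof. by rewrite !std_normal_pdfE sqrrN. Qed.

Lemma is_derive_std_normal_pdf x : is_derive x (1 : R) phi (- (x * phi x)).
Proof.
have -> : phi = fun x => normal_peak 1 * (expR \o (fun x => - (x ^+ 2) / 2)) x.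
  by apply/funext => y; rewrite std_normal_pdfE.
have dx : is_derive x (1 : R) (fun y : R => - (y ^+ 2) / 2) (- x).
  have := is_derive1M (is_derive1M (is_derive_id x (1 : R))
    (is_derive_id x (1 : R))) (is_derive_cst (- 2^-1 : R) x 1).
  have -> : (fun y : R => y * y * cst (- 2^-1) y) = (fun y : R => - (y ^+ 2) / 2).
    by apply/funext => y; rewrite /cst; field.
  by move=> H; apply: is_derive_eq; rewrite /cst /=; field.
have := is_derive1M (is_derive_cst (normal_peak 1 : R) x 1)
  (is_derive1_comp (is_derive_expR _) dx).
by move=> H; apply: is_derive_eq; rewrite /cst /=; ring.
Qed.

(** The density is bounded by its peak, so the decay of [r] alone forces the limit. It gives the
    limits of the comparison functions in [mills_bounds]. *)
Lemma cvg_std_normal_pdfM (r : R -> R) :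
  (forall x, 1 <= x -> 0 <= r x <= x^-1) -> phi x * r x @[x --> +oo] --> (0 : R).
Proof.
move=> hr; pose C := normal_peak (1 : R).
have C0 : 0 < C by rewrite normal_peak_gt0 ?oner_eq0.
apply/cvgr0Pnorm_lt => e e0; near=> x.
have x1 : 1 <= x by near: x; apply: nbhs_pinfty_ge; exact: num_real.
have xC : C / e < x by near: x; apply: nbhs_pinfty_gt; exact: num_real.
have /andP[r0 r1] := hr _ x1.
rewrite ger0_norm ?mulr_ge0 ?(ltW (std_normal_pdf_gt0 _)) //.
apply: (@le_lt_trans _ _ (C / x)).
  apply: ler_pM => //; first exact/ltW/std_normal_pdf_gt0.
  by apply: normal_pdf_ub; rewrite oner_eq0.
by rewrite ltr_pdivrMr ?(lt_le_trans ltr01) // mulrC -ltr_pdivrMr.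
Unshelve. all: by end_near. Qed.

(* [phi / w] and [w phi / (1 + w^2)] bound the Gaussian tail from above and from
   below: the differences are monotone and vanish at infinity. *)
Lemma mills_bounds (G : R -> R) c M : 1 <= M -> 0 <= c ->
  (forall x, M <= x -> is_derive x (1 : R) G (- (c * phi x))) ->
  G x @[x --> +oo] --> (0 : R) ->
  forall w, M <= w -> `|(1 + w ^+ 2) * (G w / phi w) - c * w| <= c.
Proof.
move=> M1 c0 dG G0 w Mw.
have w1 : 1 <= w by lra.
have ub : G w - c * (phi w * w^-1) <= 0.
  apply: (@le0_of_increasing_cvg0 _ (fun x => G x - c * (phi x * x^-1))
    (fun x => c * phi x / x ^+ 2) M) => //.
  - move=> x Mx; have x0 : x != 0 by rewrite gt_eqF //; lra.
    have := is_derive1B (dG _ Mx) (is_derive1M (is_derive_cst c x 1)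
      (is_derive1M (is_derive_std_normal_pdf x)
        (is_derive1V x0 (is_derive_id x (1 : R))))).
    by move=> H; apply: is_derive_eq; rewrite /cst /=; field.
  - move=> x Mx; rewrite divr_ge0 ?sqr_ge0 // mulr_ge0 //.
    exact/ltW/std_normal_pdf_gt0.
  - have H : phi x * x^-1 @[x --> +oo] --> (0 : R).
      apply: cvg_std_normal_pdfM => x x1.
      by rewrite lexx andbT invr_ge0; lra.
    by have := cvgB G0 (cvgM (cvg_cst c) H); rewrite mulr0 subr0; apply.
have lb : c * (phi w * (w / (1 + w ^+ 2))) - G w <= 0.
  apply: (@le0_of_increasing_cvg0 _
    (fun x => c * (phi x * (x / (1 + x ^+ 2))) - G x)
    (fun x => 2 * c * phi x / (1 + x ^+ 2) ^+ 2) M) => //.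
  - move=> x Mx; have x0 : 1 + x * x != 0.
      by rewrite gt_eqF // -expr2 ltr_wpDr ?sqr_ge0.
    have dq : is_derive x (1 : R) (fun y => 1 + y * y) (x + x).
      have := is_derive1B (is_derive_cst (1 : R) x 1)
        (is_derive1M (is_derive_cst (-1 : R) x 1)
        (is_derive1M (is_derive_id x (1 : R)) (is_derive_id x (1 : R)))).
      have -> : (fun y : R => cst (1 : R) y - cst (-1) y * (y * y))
         = (fun y => 1 + y * y) by apply/funext => y; rewrite /cst; ring.
      by move=> H; apply: is_derive_eq; rewrite /cst /=; ring.
    have := is_derive1B (is_derive1M (is_derive_cst c x 1)
      (is_derive1M (is_derive_std_normal_pdf x)
        (is_derive1M (is_derive_id x (1 : R))
          (@is_derive1V _ (fun y => 1 + y * y) x _ x0 dq)))) (dG _ Mx).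
    have -> : (fun y => cst c y * (phi y * (y * (1 + y * y)^-1)) - G y) =
        (fun y => c * (phi y * (y / (1 + y ^+ 2))) - G y).
      by apply/funext => y; rewrite expr2.
    by move=> H; apply: is_derive_eq; rewrite /cst /=; field.
  - move=> x Mx; rewrite divr_ge0 ?sqr_ge0 // !mulr_ge0 //.
    exact/ltW/std_normal_pdf_gt0.
  - have H : phi x * (x / (1 + x ^+ 2)) @[x --> +oo] --> (0 : R).
      apply: cvg_std_normal_pdfM => x x1.
      have x20 : 0 < 1 + x ^+ 2 by rewrite ltr_wpDr ?sqr_ge0.
      rewrite divr_ge0 ?(ltW x20) //=; last by lra.
      rewrite ler_pdivrMr // mulrDr mulr1 expr2 mulKf ?gt_eqF //; last by lra.
      by rewrite lerDr invr_ge0; lra.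
    by have := cvgB (cvgM (cvg_cst c) H) G0; rewrite mulr0 subr0; apply.
have p0 := std_normal_pdf_gt0 w; have w20 : 0 < 1 + w ^+ 2.
  by rewrite ltr_wpDr ?sqr_ge0.
have {}ub : G w / phi w <= c / w.
  rewrite ler_pdivrMr //; have -> : c / w * phi w = c * (phi w / w) by ring.
  lra.
have {}lb : c * w / (1 + w ^+ 2) <= G w / phi w.
  rewrite ler_pdivlMr //.
  have -> : c * w / (1 + w ^+ 2) * phi w = c * (phi w * (w / (1 + w ^+ 2))) by ring.
  lra.
move: lb; rewrite ler_pdivrMr // => lb.
(* By the two bounds, the quantity in the norm lies between 0 and [c / w], which is at most [c]
   since [w >= 1]. *)
rewrite ger0_norm; last by rewrite subr_ge0 [(1 + _) * _]mulrC.
rewrite lerBlDr; apply: le_trans (_ : (1 + w ^+ 2) * (c / w) <= _).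
  by rewrite ler_wpM2l // ltW.
have -> : (1 + w ^+ 2) * (c / w) = c / w + c * w.
  by field; rewrite gt_eqF //; lra.
by rewrite lerD2r ler_pdivrMr ?ler_peMr //; lra.
Qed.

End GaussianTails.

(** * The standard normal distribution function *)

Section NormalCdf.
Variable R : realType.
Local Notation phi := (@normal_pdf R 0 1).
Local Notation mu := (@lebesgue_measure R).

Definition normal_cdf (w : R) : R := fine (normal_prob 0 1 `]-oo, w]).

Lemma EFin_normal_cdf (w : R) : (normal_cdf w)%:E = normal_prob 0 1 `]-oo, w].
Proof. by rewrite /normal_cdf fineK // fin_num_measure. Qed.

(** The identity as a random variable: under the normal law its distribution function is
    [normal_cdf], which gives the limits at both infinities. *)
Let idTR : measurableTypeR R -> R := idfun.

#[local] HB.instance Definition _ :=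
  @isMeasurableFun.Build _ _ _ _ idTR (@measurable_id _ _ setT).

Lemma integrable_std_normal_pdf (D : set R) : measurable D ->
  mu.-integrable D (EFin \o phi).
Proof.
move=> mD; apply: (@integrableS _ _ _ mu setT) => //.
exact: integrable_normal_pdf.
Qed.

Lemma normal_cdf_cvgNy : normal_cdf w @[w --> -oo] --> (0 : R).
Proof.
exact/fine_cvg/(@cvg_cdfNy0 _ _ R (@normal_prob R 0 1) idTR).
Qed.

Lemma normal_cdf_cvgy : normal_cdf w @[w --> +oo] --> (1 : R).
Proof.
exact/fine_cvg/(@cvg_cdfy1 _ _ R (@normal_prob R 0 1) idTR).
Qed.

Lemma Rintegral_std_normal_pdf : \int[mu]_x phi x = 1.
Proof. by rewrite /Rintegral integral_normal_pdf. Qed.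

Lemma normal_cdf_compl w : \int[mu]_(x in `]w, +oo[) phi x = 1 - normal_cdf w.
Proof.
have := @Rintegral_itvB R phi -oo%O +oo%O w.
rewrite set_itvNyy Rintegral_std_normal_pdf => <- //.
exact: integrable_std_normal_pdf.
Qed.

(** The fundamental theorem of calculus on a half-line; [w + 1] is merely some point to the right of
    [w]. *)
Lemma is_derive_normal_cdf w : is_derive w (1 : R) normal_cdf (phi w).
Proof.
have [| | | |d e] := @continuous_FTC1 R phi -oo%O w (w + 1).
- by rewrite ltrDl.
- exact: integrable_std_normal_pdf.
- by rewrite ltNyr.
- by apply: continuous_normal_pdf; rewrite oner_eq0.
by rewrite -e derive1E; exact/derivableP.
Qed.

End NormalCdf.

(** * Solving Stein's equation for a Lipschitz function equal to 1 far left and 0 far right *)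

Section SteinEquation.
Variables (R : realType) (h : R -> R) (K p q : R).
Hypothesis h01 : forall x, 0 <= h x <= 1.
Hypothesis h_lip : forall x y, `|h x - h y| <= K * `|x - y|.
Hypothesis hp : forall x, x <= p -> h x = 1.
Hypothesis hq : forall x, q <= x -> h x = 0.
Local Notation phi := (@normal_pdf R 0 1).
Local Notation mu := (@lebesgue_measure R).

Definition normal_mean : R := \int[mu]_x (h x * phi x).

Let c := normal_mean.
(** [f = F / phi] is the classical solution: [F' = (h - c) phi] and [phi' w = - w phi w] give
    [f' w = w f w + h w - c]. Subtracting the mean [c] makes [F] vanish at both infinities. *)
Let g x := (h x - c) * phi x.
Let F w := \int[mu]_(x in `]-oo, w]) g x.
Let f w := F w / phi w.

Let phi_ge0 x : 0 <= phi x. Proof. exact/ltW/std_normal_pdf_gt0. Qed.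

Let h_cont : continuous h.
Proof.
move=> x; apply/cvgrPdist_lt => e e0; near=> y.
have K1 : 0 < `|K| + 1 by rewrite ltr_wpDl.
apply: (@le_lt_trans _ _ ((`|K| + 1) * `|x - y|)).
  apply: (le_trans (h_lip _ _)); rewrite ler_wpM2r //.
  by rewrite (le_trans (ler_norm _)) // lerDl.
rewrite -ltr_pdivlMl //.
near: y; apply: cvgr_dist_lt; first exact: cvg_id.
by rewrite mulr_gt0 // invr_gt0.
Unshelve. all: by end_near. Qed.

Let phi_cont : continuous phi.
Proof. by apply: continuous_normal_pdf; rewrite oner_eq0. Qed.

Let dominated_integrable (k : R -> R) (D : set R) : measurable D -> continuous k ->
  (forall x, `|k x| <= phi x) -> mu.-integrable D (EFin \o k).
Proof.
move=> mD ck kphi; apply: (@integrableS _ _ _ mu setT) => //.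
apply: (@le_integrable _ _ _ mu setT _ _ (EFin \o phi)) => //.
- by apply/measurable_EFinP; apply: continuous_measurable_fun.
- by move=> x _ /=; rewrite lee_fin (le_trans (kphi x)) // ler_norm.
- exact: integrable_std_normal_pdf.
Qed.

Let hphi_cont : continuous (fun x => h x * phi x).
Proof. by move=> x; apply: cvgM; [exact: h_cont|exact: phi_cont]. Qed.

Let hphi_dom x : `|h x * phi x| <= phi x.
Proof.
have /andP[h0 h1] := h01 x.
by rewrite ger0_norm ?mulr_ge0 // ler_piMl.
Qed.

(** The function [h] is 1 up to [p] and nonnegative beyond. With [normal_mean_le], this places the
    Gaussian mean of a ramp between two values of [normal_cdf]. *)
Lemma normal_mean_ge : normal_cdf p <= c.
Proof.
rewrite /c /normal_mean.
have -> : normal_cdf p = \int[mu]_(x in `]-oo, p]) (h x * phi x).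
  by apply: eq_Rintegral => x /set_mem /=; rewrite in_itv /= => /hp ->; rewrite mul1r.
rewrite -[X in _ <= X](subrK (\int[mu]_(x in `]-oo, p]) (h x * phi x))).
rewrite lerDr.
have := @Rintegral_itvB R (fun x => h x * phi x) -oo%O +oo%O p.
rewrite set_itvNyy => -> //; last exact: dominated_integrable.
by apply: Rintegral_ge0 => x _; have /andP[h0 h1] := h01 x; rewrite mulr_ge0.
Qed.

Lemma normal_mean_le : c <= normal_cdf q.
Proof.
rewrite /c /normal_mean.
have := @Rintegral_itvB R (fun x => h x * phi x) -oo%O +oo%O q.
rewrite set_itvNyy => /(_ (dominated_integrable _ hphi_cont hphi_dom) isT isT).
have -> : \int[mu]_(x in `]q, +oo[) (h x * phi x) = 0.
  rewrite (@eq_Rintegral _ _ _ mu _ (cst 0)); first by rewrite Rintegral_cst // mul0r.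
  by move=> x /set_mem /=; rewrite in_itv /= andbT => /ltW /hq ->; rewrite mul0r.
move=> /(_ measurableT) /subr0_eq ->.
apply: le_Rintegral => //;
  [exact: dominated_integrable|exact: integrable_std_normal_pdf|].
by move=> x _; have /andP[h0 h1] := h01 x; rewrite ler_piMl.
Qed.

Let c01 : 0 <= c <= 1.
Proof.
rewrite /c /normal_mean; apply/andP; split.
  by apply: Rintegral_ge0 => x _; have /andP[h0 h1] := h01 x; rewrite mulr_ge0.
rewrite -[X in _ <= X]Rintegral_std_normal_pdf.
apply: le_Rintegral => //;
  [exact: dominated_integrable|exact: integrable_std_normal_pdf|].
by move=> x _; have /andP[h0 h1] := h01 x; rewrite ler_piMl.
Qed.

Let g_cont : continuous g.
Proof.
move=> x; apply: cvgM; last exact: phi_cont.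
by apply: cvgB; [exact: h_cont|exact: cvg_cst].
Qed.

Let g_dom x : `|g x| <= phi x.
Proof.
rewrite normrM (ger0_norm (phi_ge0 x)) ler_piMl // ler_norml.
by have /andP[h0 h1] := h01 x; have /andP[c0 c1] := c01; apply/andP; split; lra.
Qed.

Let g_int (D : set R) : measurable D -> mu.-integrable D (EFin \o g).
Proof. by move=> mD; exact: dominated_integrable. Qed.

Let g_mean0 : \int[mu]_x g x = 0.
Proof.
rewrite (@eq_Rintegral _ _ _ mu _ (fun x => h x * phi x - c * phi x)); last first.
  by move=> x _; rewrite /g mulrBl.
rewrite RintegralB //.
- rewrite RintegralZl //; last exact: integrable_std_normal_pdf.
  by rewrite Rintegral_std_normal_pdf mulr1 subrr.
- exact: dominated_integrable.
- apply: (@dominated_integrable (fun x => c * phi x)) => //.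
    by move=> x; apply: cvgM; [exact: cvg_cst|exact: phi_cont].
  move=> x; have /andP[c0 c1] := c01.
  by rewrite ger0_norm ?mulr_ge0 // ler_piMl.
Qed.

Let g_abs (D : set R) : measurable D ->
  `|\int[mu]_(x in D) g x| <= \int[mu]_(x in D) phi x.
Proof.
move=> mD; have H := @le_normr_Rintegral _ _ R mu D g mD (g_int mD).
apply: (le_trans H).
apply: le_Rintegral => //; last exact: integrable_std_normal_pdf.
apply: (@dominated_integrable (fun x => `|g x|)) => //.
  by move=> x; apply: cvg_norm; exact: g_cont.
by move=> x; rewrite normr_id.
Qed.

Let F_cvgNy : F w @[w --> -oo] --> (0 : R).
Proof.
apply/cvgr0Pnorm_lt => e e0; near=> w.
apply: le_lt_trans (g_abs _) _ => //.
suff : `|normal_cdf w| < e by apply: le_lt_trans; exact: ler_norm.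
near: w; move: e e0; apply/(@cvgr0Pnorm_lt _ R^o); exact: normal_cdf_cvgNy.
Unshelve. all: by end_near. Qed.

(** The total integral of [g] is 0, so [F w] is minus the integral over the right tail, which the
    normal tail dominates. *)
Let F_cvgy : F w @[w --> +oo] --> (0 : R).
Proof.
apply/cvgr0Pnorm_lt => e e0; near=> w.
have := @Rintegral_itvB R g -oo%O +oo%O w.
rewrite set_itvNyy g_mean0 add0r => /(_ (g_int measurableT) isT isT) Fw.
rewrite -normrN Fw; apply: le_lt_trans (g_abs _) _ => //.
rewrite normal_cdf_compl.
suff : `|1 - normal_cdf w| < e by apply: le_lt_trans; exact: ler_norm.
near: w; move: e e0; apply/(@cvgrPdist_lt _ R^o); exact: normal_cdf_cvgy.
Unshelve. all: by end_near. Qed.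

Let F_der w : is_derive w (1 : R) F (g w).
Proof.
have [| | | |d e] := @continuous_FTC1 R g -oo%O w (w + 1).
- by rewrite ltrDl.
- exact: g_int.
- by rewrite ltNyr.
- exact: g_cont.
by rewrite -e derive1E; exact/derivableP.
Qed.

Let f_der w : is_derive w (1 : R) f (w * f w + h w - c).
Proof.
have p0 : phi w != 0 by rewrite gt_eqF // std_normal_pdf_gt0.
have H := is_derive1M (F_der w) (is_derive1V p0 (is_derive_std_normal_pdf w)).
by apply: (is_derive_eq H); rewrite /f /g; field.
Qed.

(** This is the derivative of [w * f w], once [f'] is replaced by means of Stein's equation. *)
Let k w := (1 + w ^+ 2) * f w + w * (h w - c).

Let k_cont : continuous k.
Proof.
move=> w; apply: cvgD.
  apply: cvgM; last exact: is_derive_continuous (f_der w).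
  by apply: cvgD; [exact: cvg_cst|exact: sqr_continuous].
apply: cvgM; first exact: cvg_id.
by apply: cvgB; [exact: h_cont|exact: cvg_cst].
Qed.

(** Far right, [h = 0] and [k] is the expression bounded in [mills_bounds] with constant [c]. Far
    left, [h = 1] and the reflected [F] falls under the same bound with constant [1 - c]. In
    between, continuity suffices. *)
Let k_bounded : exists2 L, 0 <= L & forall w, `|k w| <= L.
Proof.
have /andP[c0 c1] := c01.
(* Beyond [M] in absolute value, [h] is constant, and [M >= 1] as the tail bounds require. *)
pose M := 1 + `|p| + `|q|.
have pM := ler_norm (- p); rewrite normrN in pM.
have qM := ler_norm q; have p0 := normr_ge0 p; have q0 := normr_ge0 q.
have [L L0 HL] := continuous_bounded_itv (- M) M k_cont.
exists (L + 1); first by lra.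
move=> w; have [wM|Mw] := leP w M; last first.
  suff : `|k w| <= c by lra.
  have := @mills_bounds R F c M; rewrite /k hq; last by rewrite /M in Mw; lra.
  rewrite sub0r mulrN [w * c]mulrC; apply => //; try by rewrite /M; lra.
  - move=> x Mx; apply: (is_derive_eq (F_der x)); rewrite /g hq ?sub0r ?mulNr //.
    by rewrite /M in Mx; lra.
  - exact: ltW.
have [Mw|wM'] := leP (- M) w.
  by have := HL w; rewrite Mw wM => /(_ isT); lra.
suff : `|k w| <= 1 - c by lra.
have := @mills_bounds R (F \o -%R) (1 - c) M _ _ _ _ (- w).
rewrite /k hp /=; last by rewrite /M in wM'; lra.
rewrite opprK std_normal_pdfN sqrrN mulrN opprK [w * _]mulrC; apply => //.
- by rewrite /M; lra.
- by lra.
- move=> x Mx.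
  apply: (is_derive_eq (is_derive1_comp (F_der (- x))
    (is_deriveN (is_derive_id x (1 : R))))).
  rewrite /g hp ?std_normal_pdfN; first by rewrite mulrN1.
  by rewrite /M in Mx; lra.
- by have := F_cvgNy; rewrite cvgNy_compNP; apply.
- by lra.
Qed.

(** Up to a constant, [f'] is the sum of [w * f w], whose derivative [k] is bounded, and of the
    [K]-Lipschitz function [h]. *)
Lemma stein_solution : exists f L, [/\
  0 <= L, forall w, is_derive w (1 : R) f (w * f w + h w - normal_mean) &
  forall x y, `|(x * f x + h x - normal_mean) - (y * f y + h y - normal_mean)|
    <= L * `|x - y|].
Proof.
have [L L0 kL] := k_bounded.
have K0 : 0 <= K.
  by have := h_lip 1 0; rewrite subr0 normr1 mulr1; apply: le_trans.
exists f, (L + K); split; [by lra|exact: f_der|move=> x y].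
have wf_der w : is_derive w (1 : R) (fun w => w * f w) (k w).
  apply: (is_derive_eq (is_derive1M (is_derive_id w (1 : R)) (f_der w))).
  by rewrite /k -/c; ring.
have [z e _] := MVT_between y x wf_der.
have -> : x * f x + h x - normal_mean - (y * f y + h y - normal_mean) =
  (x * f x - y * f y) + (h x - h y) by ring.
rewrite mulrDl (le_trans (ler_normD _ _)) // lerD // e normrM ler_wpM2r //.
Qed.

End SteinEquation.

(** * Central limit theorem *)

Section Ramp.
Variables (R : realType) (p q : R).
Hypothesis pq : p < q.

(** Lipschitz substitute for the indicator of [x <= t]: a lower bound of it when [q = t], an upper
    bound when [p = t]. *)
Definition ramp (x : R) : R := Num.max 0 (Num.min 1 ((q - x) / (q - p))).

Let qp : 0 < q - p. Proof. by rewrite subr_gt0. Qed.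

Lemma ramp_ge0_le1 x : 0 <= ramp x <= 1.
Proof. by rewrite /ramp le_max lexx /= ge_max ler01 ge_min lexx. Qed.

Lemma ramp_eq1 x : x <= p -> ramp x = 1.
Proof.
move=> xp; rewrite /ramp (min_idPl _) ?(max_idPr _) //.
by rewrite ler_pdivlMr // mul1r; lra.
Qed.

Lemma ramp_eq0 x : q <= x -> ramp x = 0.
Proof.
move=> qx; rewrite /ramp (max_idPl _) // ge_min; apply/orP; right.
by rewrite pmulr_lle0 ?invr_gt0 //; lra.
Qed.

Lemma ramp_lipschitz x y : `|ramp x - ramp y| <= (q - p)^-1 * `|x - y|.
Proof.
(* Clamping to the unit interval does not increase distances. *)
have H (a b : R) : `|Num.max 0 (Num.min 1 a) - Num.max 0 (Num.min 1 b)| <= `|a - b|.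
  have := ler_norm (a - b); have := ler_norm (b - a); rewrite [X in _ <= X]distrC.
  rewrite ler_norml; case: (leP 1 a) => ?; case: (leP 1 b) => ?;
    case: (leP (0 : R) 1) => ?; case: (leP 0 a) => ?; case: (leP 0 b) => ? ? ?;
    apply/andP; split; lra.
apply: (le_trans (H _ _)).
have -> : (q - x) / (q - p) - (q - y) / (q - p) = (q - p)^-1 * (y - x) by ring.
by rewrite normrM distrC ger0_norm // invr_ge0 ltW.
Qed.

End Ramp.

(** * Averages over a finite sample *)

Section Average.
Variables (R : realType) (T : eqType) (s : seq T).
Hypothesis s_gt0 : (0 < size s)%N.
Implicit Types f g : T -> R.

Definition avg f : R := (\sum_(x <- s) f x) / (size s)%:R.

Let size_gt0 : 0 < (size s)%:R :> R. Proof. by rewrite ltr0n. Qed.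

Lemma eq_avg f g : {in s, f =1 g} -> avg f = avg g.
Proof. by move=> fg; rewrite /avg; congr (_ / _); exact: eq_big_seq. Qed.

Lemma avg_cst c : avg (fun=> c) = c.
Proof.
by rewrite /avg big_const_seq count_predT iter_addr_0 -[c *+ _]mulr_natr mulfK ?gt_eqF.
Qed.

Lemma avgD f g : avg (fun x => f x + g x) = avg f + avg g.
Proof. by rewrite /avg big_split /= mulrDl. Qed.

Lemma avgZ c f : avg (fun x => c * f x) = c * avg f.
Proof. by rewrite /avg -big_distrr /= mulrA. Qed.

Lemma avgB f g : avg (fun x => f x - g x) = avg f - avg g.
Proof.
rewrite -mulN1r -avgZ -avgD; apply: eq_avg => x _; by rewrite mulN1r.
Qed.

Lemma avg_sum (I : Type) (r : seq I) (F : I -> T -> R) :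
  avg (fun x => \sum_(i <- r) F i x) = \sum_(i <- r) avg (F i).
Proof. by rewrite /avg exchange_big /= big_distrl. Qed.

Lemma le_avg f g : {in s, forall x, f x <= g x} -> avg f <= avg g.
Proof.
move=> fg; rewrite /avg ler_pM2r ?invr_gt0 //.
by rewrite big_seq [leRHS]big_seq; apply: ler_sum.
Qed.

Lemma avg_ge0 f : {in s, forall x, 0 <= f x} -> 0 <= avg f.
Proof. by move=> /le_avg; rewrite avg_cst. Qed.

Lemma ler_norm_avg f : `|avg f| <= avg (fun x => `|f x|).
Proof.
rewrite ler_norml; apply/andP; split; last by apply: le_avg => x _; exact: ler_norm.
rewrite -mulN1r -avgZ; apply: le_avg => x _.
by rewrite mulN1r lerNl -normrN ler_norm.
Qed.

End Average.

(** * Stein's bound for sums of small independent variables *)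

Section SteinBound.
Variables (R : realType) (T : eqType) (s : seq T).
Hypothesis s_gt0 : (0 < size s)%N.
Variables (r : seq nat) (xi : nat -> T -> R) (eps : R).
Local Notation E := (@avg R T s).
Local Notation W := (fun x => \sum_(n <- r) xi n x).
Hypothesis xi_mean : forall n, n \in r -> E (xi n) = 0.
Hypothesis xi_indep : forall n, n \in r -> forall u v : R -> R,
  E (fun x => u (xi n x) * v (W x - xi n x)) =
  E (fun x => u (xi n x)) * E (fun x => v (W x - xi n x)).
Hypothesis xi_small : forall n x, n \in r -> x \in s -> `|xi n x| <= eps.
Hypothesis xi_var : \sum_(n <- r) E (fun x => xi n x ^+ 2) = 1.

(** Expand [f (W x)] around [W x - xi n x], which is independent of [xi n]. In the average of
    [xi n * f W], the constant term vanishes by centering and the linear term yields the variance of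
    [xi n] times the average of [df (W - xi n)]. Since the variances add up to 1, these terms cancel
    the average of [df W] up to errors, two for each [n], bounded by [L * eps] times the variance of
    [xi n]. *)
Lemma stein_bound (f df : R -> R) (L : R) : 0 <= L ->
  (forall w, is_derive w (1 : R) f (df w)) ->
  (forall x y, `|df x - df y| <= L * `|x - y|) ->
  `|E (fun x => df (W x) - W x * f (W x))| <= 2 * L * eps.
Proof.
move=> L0 fdf dfL.
(* The first-order Taylor remainder; it is quadratic in [xi n] because [df] is Lipschitz. *)
pose rho n x := f (W x) - f (W x - xi n x) - xi n x * df (W x - xi n x).
have rho_le n x : `|rho n x| <= L * xi n x ^+ 2.
  have [z e zle] := MVT_between (W x - xi n x) (W x) fdf.
  have eW : W x - (W x - xi n x) = xi n x by ring.
  rewrite eW in e zle.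
  rewrite /rho e; have -> : df z * xi n x - xi n x * df (W x - xi n x) =
    (df z - df (W x - xi n x)) * xi n x by ring.
  rewrite normrM -[xi n x ^+ 2]ger0_norm ?sqr_ge0 // normrX expr2 mulrA.
  rewrite ler_wpM2r //; apply: (le_trans (dfL _ _)); exact: ler_wpM2l.
(* The two errors due to [xi n]: the shift of the argument of [df], and the Taylor remainder. *)
pose term n := E (fun x => xi n x ^+ 2) * E (fun x => df (W x) - df (W x - xi n x))
  - E (fun x => xi n x * rho n x).
have -> : E (fun x => df (W x) - W x * f (W x)) = \sum_(n <- r) term n.
  rewrite avgB -[E (fun x => df (W x))]mul1r -xi_var.
  have -> : E (fun x => W x * f (W x)) = \sum_(n <- r) E (fun x => xi n x * f (W x)).
    by rewrite -avg_sum; apply: eq_avg => x _; rewrite -big_distrl.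
  rewrite big_distrl /= -sumrB; apply: eq_big_seq => n nr.
  have -> : E (fun x => xi n x * f (W x)) = E (fun x => xi n x * rho n x) +
      (E (fun x => xi n x * f (W x - xi n x)) +
       E (fun x => xi n x ^+ 2 * df (W x - xi n x))).
    by rewrite -!avgD; apply: eq_avg => x _; rewrite /rho; ring.
  rewrite (xi_indep nr (fun y => y)) xi_mean // mul0r add0r.
  rewrite (xi_indep nr (fun y => y ^+ 2)) /term avgB.
  by ring.
apply: le_trans (ler_norm_sum _ _ _) _.
have -> : 2 * L * eps = 2 * L * eps * \sum_(n <- r) E (fun x => xi n x ^+ 2).
  by rewrite xi_var mulr1.
rewrite big_distrr /=.
rewrite big_seq [leRHS]big_seq; apply: ler_sum => n nr.
have sq0 : 0 <= E (fun x => xi n x ^+ 2).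
  by apply: avg_ge0 => // x _; exact: sqr_ge0.
have -> : 2 * L * eps * E (fun x => xi n x ^+ 2) =
   E (fun x => xi n x ^+ 2) * (L * eps) + L * eps * E (fun x => xi n x ^+ 2).
  by ring.
rewrite /term (le_trans (ler_normB _ _)) // lerD //.
  rewrite normrM (ger0_norm sq0) ler_wpM2l // (le_trans (ler_norm_avg s_gt0 _)) //.
  rewrite -[leRHS](avg_cst s_gt0); apply: le_avg => // x xs.
  apply: (le_trans (dfL _ _)); rewrite ler_wpM2l //.
  by rewrite subKr xi_small.
apply: (le_trans (ler_norm_avg s_gt0 _)); rewrite -avgZ; apply: le_avg => // x xs.
rewrite normrM; have -> : L * eps * xi n x ^+ 2 = eps * (L * xi n x ^+ 2) by ring.
by apply: ler_pM => //; exact: xi_small.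
Qed.

End SteinBound.

(** * From ramps to distribution functions *)

Section CentralLimit.
Variables (R : realType) (T : eqType).

(** Independence has the form used by Stein's method: each summand is independent of the sum of the
    others. *)
Definition standardized (s : seq T) (r : seq nat) (xi : nat -> T -> R) (eps : R) :=
  [/\ (0 < size s)%N,
      forall n, n \in r -> avg s (xi n) = 0,
      forall n, n \in r -> forall u v : R -> R,
        let V x := (\sum_(k <- r) xi k x) - xi n x in
        avg s (fun x => u (xi n x) * v (V x)) =
        avg s (fun x => u (xi n x)) * avg s (fun x => v (V x)),
      forall n x, n \in r -> x \in s -> `|xi n x| <= eps &
      \sum_(n <- r) avg s (fun x => xi n x ^+ 2) = 1].

(** The constant [L] depends on the ramp only, so that one constant serves for all [N] in
    [clt_standardized]. *)
Lemma stein_ramp (p q : R) : p < q -> exists2 L, 0 <= L &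
  forall s r xi eps, standardized s r xi eps ->
  `|avg s (fun x => ramp p q (\sum_(n <- r) xi n x)) - normal_mean (ramp p q)|
    <= L * eps.
Proof.
move=> pq.
have [f [L [L0 fdf dfL]]] := stein_solution (ramp_ge0_le1 p q)
  (ramp_lipschitz pq) (ramp_eq1 pq) (ramp_eq0 pq).
exists (2 * L); first by rewrite mulr_ge0.
move=> s r xi eps [s0 mean0 ind small var1].
have := stein_bound s0 mean0 ind small var1 L0 fdf dfL.
rewrite (@eq_avg _ _ _ _
  (fun x => ramp p q (\sum_(n <- r) xi n x) - normal_mean (ramp p q))).
  by rewrite avgB avg_cst.
by move=> x _ /=; ring.
Qed.

Variables (s : nat -> seq T) (r : nat -> seq nat) (xi : nat -> nat -> T -> R).
Variable eps : nat -> R.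

(** The indicator lies between two ramps of width [d / 2] on either side of [t]. Their Gaussian
    means are within [e / 2] of [normal_cdf t] by continuity, and the error in Stein's bound is
    eventually at most [e / 2]. *)
Lemma clt_standardized :
  (\forall N \near \oo, standardized (s N) (r N) (xi N) (eps N)) ->
  eps N @[N --> \oo] --> (0 : R) -> forall t : R,
  avg (s N) (fun x => (\sum_(n <- r N) xi N n x <= t)%R%:R) @[N --> \oo]
    --> normal_cdf t.
Proof.
move=> std eps0 t; apply/cvgrPdist_le => e e0.
have /cvgrPdist_le /(_ (e / 2)) : normal_cdf w @[w --> t] --> normal_cdf t.
  exact: is_derive_continuous (is_derive_normal_cdf t).
rewrite divr_gt0 // => /(_ isT) /nbhs_ballP [d /= d0 dP].
have close w : `|t - w| <= d / 2 -> `|normal_cdf t - normal_cdf w| <= e / 2.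
  by move=> tw; apply: dP; rewrite /ball /=; lra.
have t1 : t - d / 2 < t by rewrite gtrBl divr_gt0.
have t2 : t < t + d / 2 by rewrite ltrDl divr_gt0.
have [L1 L10 H1] := stein_ramp t1; have [L2 L20 H2] := stein_ramp t2.
have small L : 0 <= L -> \forall N \near \oo, L * eps N <= e / 2.
  move=> L0.
  have : L * eps N @[N --> \oo] --> (0 : R).
    by rewrite -[X in _ --> X](mulr0 L); apply: cvgM => //; exact: cvg_cst.
  by move=> /cvgr_le; apply; rewrite divr_gt0.
near=> N.
have stdN : standardized (s N) (r N) (xi N) (eps N) by near: N.
have s0 : (0 < size (s N))%N by case: stdN.
have {}H1 := H1 _ _ _ _ stdN; have {}H2 := H2 _ _ _ _ stdN.
have e1 : L1 * eps N <= e / 2 by near: N; exact: small.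
have e2 : L2 * eps N <= e / 2 by near: N; exact: small.
have c1 := close (t - d / 2); have c2 := close (t + d / 2).
have m1 := normal_mean_ge (ramp_ge0_le1 (t - d / 2) t) (ramp_lipschitz t1)
  (ramp_eq1 t1).
have m2 := normal_mean_le (ramp_ge0_le1 t (t + d / 2)) (ramp_lipschitz t2)
  (ramp_eq0 t2).
have a1 : avg (s N) (fun x => ramp (t - d / 2) t (\sum_(n <- r N) xi N n x)) <=
          avg (s N) (fun x => (\sum_(n <- r N) xi N n x <= t)%R%:R) :> R.
  apply: le_avg => // x _; have [_|/ltW /(ramp_eq0 t1) -> //] := leP _ t.
  by have /andP[] := ramp_ge0_le1 (t - d / 2) t (\sum_(n <- r N) xi N n x).
have a2 : avg (s N) (fun x => (\sum_(n <- r N) xi N n x <= t)%R%:R) <=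
          avg (s N) (fun x => ramp t (t + d / 2) (\sum_(n <- r N) xi N n x)) :> R.
  apply: le_avg => // x _; have [/(ramp_eq1 t2) -> //|_] := leP _ t.
  by have /andP[] := ramp_ge0_le1 t (t + d / 2) (\sum_(n <- r N) xi N n x).
move: H1 H2 c1 c2; rewrite !ler_norml => /andP[? ?] /andP[? ?].
move=> /(_ _)/andP[]; first by apply/andP; split; lra.
move=> ? ? /(_ _)/andP[]; first by apply/andP; split; lra.
move=> ? ?; apply/andP; split; lra.
Unshelve. all: by end_near. Qed.

End CentralLimit.

(** * Bin sequences *)

Section Bins.
Variable bs : nat -> nat.
Local Notation bin_end := (bin_end bs).
Local Notation in_bin := (in_bin bs).

Lemma bin_endS n : bin_end n.+1 = (bin_end n + bs n.+1)%N.
Proof. by rewrite /bin_end big_nat_recr. Qed.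

Lemma leq_bin_end n k : (n <= k)%N -> (bin_end n <= bin_end k)%N.
Proof.
move=> /subnKC <-; elim: (k - n)%N => [|j IH]; first by rewrite addn0.
by rewrite addnS bin_endS (leq_trans IH) ?leq_addr.
Qed.

Lemma in_bin_inj n k i : in_bin n i -> in_bin k i -> n = k.
Proof.
move=> /andP[n1 n2] /andP[k1 k2]; apply/eqP; rewrite eqn_leq; apply/andP.
by split; rewrite leqNgt; apply/negP => lt;
   [have := @leq_bin_end k n.-1|have := @leq_bin_end n k.-1]; lia.
Qed.

Lemma in_bin_bin_end N n i : (n <= N)%N -> in_bin n i -> (i < bin_end N)%N.
Proof. by move=> /leq_bin_end nN /andP[_ i2]; lia. Qed.

Definition bin_set (N n : nat) : {set 'I_(bin_end N)} :=
  [set i : 'I_(bin_end N) | in_bin n i].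

Lemma bin_set_disj N n k : n != k -> bin_set N n :&: bin_set N k = finset.set0.
Proof.
move=> /eqP nk; apply/setP => i; rewrite !inE; apply/negP => /andP[ni ki].
exact: nk (in_bin_inj ni ki).
Qed.

Lemma card_bin_set N n : (1 <= n <= N)%N -> #|bin_set N n| = bs n.
Proof.
move=> /andP[n1 nN]; rewrite -sum1dep_card.
rewrite -(@big_mkord _ _ addn (bin_end N) (in_bin n) (fun=> 1%N)).
rewrite -(@big_nat_widen _ _ addn 0 _ _ (fun i => bin_end n.-1 <= i)%N);
  last exact: leq_bin_end.
rewrite -(@big_nat_widenl _ _ addn (bin_end n.-1) 0 _ xpredT) //.
by rewrite sum_nat_const_nat muln1 -{1}(prednK n1) bin_endS (prednK n1) addKn.
Qed.

End Bins.

(** * Integers with largest summand in bin [N] as legal sets of indices *)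

Section Transfer.
Variables (bs : nat -> nat) (A : {fset nat}) (a : nat -> nat).
Hypothesis bs_gt0 : forall n, (1 <= n)%N -> (0 < bs n)%N.
Hypothesis A_0 : 0%N \in A.
Hypothesis A_1 : 1%N \in A.
Hypothesis a_seq : bin_sequence bs A a.
Hypothesis a_uniq : unique_decompositions bs A a.

Lemma term_gt0 k : (0 < a k)%N.
Proof. by case: a_seq => a0 H; case: k => [|k]; rewrite ?a0 //; case: (H k.+1). Qed.

Lemma bin_count_le n (D : {fset nat}) : (bin_count bs n D <= #|` D|)%N.
Proof. by apply: fsubset_leq_card; apply: fset_sub. Qed.

Lemma legal_with_first_term k : legal_with_first bs A a k.+1 (a k).
Proof.
exists [fset k]; last by move=> i; rewrite inE => /eqP ->.
split; first by rewrite big_seq_fset1.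
move=> n; have := bin_count_le n [fset k]; rewrite cardfs1.
by case: (bin_count _ _ _) => [|[|]].
Qed.

(** Equality is excluded because [a k] alone is a legal decomposition. If [a k.+1] were smaller than
    [a k], the minimality of [a k] would make it legal with even fewer terms. *)
Lemma term_ltS k : (a k < a k.+1)%N.
Proof.
case: a_seq => a0 H; case: (H k.+1) => // _ notlegal _.
have [lt|gt|e] := ltngtP (a k) (a k.+1) => //; last first.
  by case: notlegal; rewrite -e; exact: legal_with_first_term.
case: k gt notlegal => [|k] gt notlegal.
  by rewrite a0 in gt; have := term_gt0 1; lia.
case: (H k.+1) => // _ _ leastk.
have [D DL Dk] : legal_with_first bs A a k.+1 (a k.+2).
  by apply: contrapT => /leastk; rewrite term_gt0 => /(_ isT); lia.
by case: notlegal; exists D => // i /Dk; lia.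
Qed.

Lemma term_lt i j : (i < j)%N -> (a i < a j)%N.
Proof.
move=> ij; rewrite -(subnKC ij); elim: (j - i.+1)%N => [|d IH].
  by rewrite addn0 term_ltS.
by rewrite addnS (ltn_trans IH) ?term_ltS.
Qed.

Lemma legal_decomposition0 : legal_decomposition bs A a 0 fset0.
Proof.
split=> [|n]; first by rewrite big_seq_fset0.
by have := bin_count_le n fset0; rewrite cardfs0 leqn0 => /eqP ->.
Qed.

Lemma decompositionP x : legal_decomposition bs A a x (decomposition bs A a x).
Proof.
suff [D HD] : exists D, legal_decomposition bs A a x D.
  exact: (@xgetPex _ fset0 [set D | legal_decomposition bs A a x D]
    (ex_intro _ D HD)).
case: x => [|x]; first by exists fset0; exact: legal_decomposition0.
by have [D [DL _]] := a_uniq (ltn0Sn x); exists D.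
Qed.

Lemma decomposition_uniq x D : (0 < x)%N -> legal_decomposition bs A a x D ->
  decomposition bs A a x = D.
Proof.
move=> x0 DL; have [D' [_ U]] := a_uniq x0.
by rewrite -(U _ DL) -(U _ (decompositionP x)).
Qed.

Variable N : nat.
Hypothesis N_gt0 : (1 <= N)%N.
Local Notation M := (bin_end bs N).

(** The nonzero count in bin [N] encodes that the largest summand lies there. *)
Definition count_ok (n k : nat) : bool := (k \in A) && ((n == N) ==> (k != 0%N)).

Definition legal_sets : {set {set 'I_M}} := block_family N (bin_set bs N) count_ok.

Definition terms_sum (D : {set 'I_M}) : nat := (\sum_(i in D) a i)%N.

Let idx (D : {set 'I_M}) : {fset nat} := [fset val i | i in D].

Let mem_idx (D : {set 'I_M}) (i : 'I_M) : (val i \in idx D) = (i \in D).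
Proof.
apply/imfsetP/idP => [[j /= jD /val_inj ->] //|iD]; by exists i.
Qed.

Let bin_count_idx n D : bin_count bs n (idx D) = #|D :&: bin_set bs N n|.
Proof.
rewrite /bin_count cardE -(size_map val (enum _)).
apply: perm_size; apply: uniq_perm; first exact: fset_uniq.
  by rewrite map_inj_uniq ?enum_uniq //; exact: val_inj.
move=> i; rewrite !inE /=; apply/andP/mapP => [[/imfsetP[j /= jD ->] ji]|[j]].
  by exists j => //; rewrite mem_enum !inE jD ji.
by rewrite mem_enum !inE => /andP[jD ji] ->; rewrite mem_idx.
Qed.

Let sum_idx D : (\sum_(i <- idx D) a i)%N = terms_sum D.
Proof.
rewrite /terms_sum -big_enum /= -(big_map val xpredT a) /=.
apply: perm_big; apply: uniq_perm; first exact: fset_uniq.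
  by rewrite map_inj_uniq ?enum_uniq //; exact: val_inj.
move=> i; apply/imfsetP/mapP => [[j /= jD ->]|[j]].
  by exists j => //; rewrite mem_enum.
by rewrite mem_enum => jD ->; exists j.
Qed.

Let bin_set_gt n : (N < n)%N -> bin_set bs N n = finset.set0.
Proof.
move=> Nn; apply/setP => i; rewrite !inE; apply/negP => /andP[i1 _].
by have := @leq_bin_end bs N n.-1; have := ltn_ord i; lia.
Qed.

Let legal_idx D : D \in legal_sets -> legal_decomposition bs A a (terms_sum D) (idx D).
Proof.
move=> /block_familyP DL; split=> [|n]; first exact: sum_idx.
rewrite bin_count_idx; have [/DL /andP[] //|Nn] := leqP n N.
by rewrite bin_set_gt // finset.setI0 cards0.
Qed.

Let legal_sets_last D : D \in legal_sets -> exists2 i, i \in D & in_bin bs N i.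
Proof.
move=> /block_familyP /(_ N (leqnn N)) /andP[_]; rewrite eqxx /= cards_eq0.
by case/set0Pn => i; rewrite !inE => /andP[iD iN]; exists i.
Qed.

Let terms_sum_gt0 D : D \in legal_sets -> (0 < terms_sum D)%N.
Proof.
move=> /legal_sets_last [i iD _].
by rewrite /terms_sum (bigD1 i) //=; have := term_gt0 i; lia.
Qed.

Let decomposition_idx D : D \in legal_sets ->
  decomposition bs A a (terms_sum D) = idx D.
Proof. by move=> DL; apply: decomposition_uniq (legal_idx DL); exact: terms_sum_gt0. Qed.

Lemma Y_terms_sum D n : D \in legal_sets ->
  Y bs A a n (terms_sum D) = #|D :&: bin_set bs N n|.
Proof. by move=> DL; rewrite /Y decomposition_idx. Qed.

Lemma Y_in_A n x : Y bs A a n x \in A.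
Proof. by case: (decompositionP x) => _; apply. Qed.

Lemma terms_sum_inj : {in legal_sets &, injective terms_sum}.
Proof.
move=> D D' DL D'L e; apply/setP => i.
by rewrite -!mem_idx -!decomposition_idx // e.
Qed.

(** Terms increase with their index, so the largest summand is the one of largest index, and every
    other summand lies in the first [N] bins. *)
Lemma largest_in_binE x :
  largest_in_bin bs A a N x <-> exists2 D, D \in legal_sets & x = terms_sum D.
Proof.
split=> [[i iD [iN imax]]|[D DL ->]]; last first.
  have [j jD jN] := legal_sets_last DL.
  (* The largest index of [D] is at least [j] and below the end of bin [N], hence in bin [N]. *)
  pose m := [arg max_(k > j | k \in D) val k]%N.
  have [mD mmax] : m \in D /\ forall k, k \in D -> (k <= m)%N.
    by rewrite /m; case: arg_maxnP.
  exists (val m); rewrite decomposition_idx ?mem_idx //; split.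
    have := mmax _ jD; have := ltn_ord m; rewrite /in_bin.
    by move: jN => /andP[] /=; lia.
  move=> k /imfsetP[k' /= k'D ->].
  by have := mmax _ k'D; rewrite leq_eqVlt => /predU1P[->//|/term_lt /ltnW].
have [xE xA] := decompositionP x.
pose D : {set 'I_M} := [set j : 'I_M | val j \in decomposition bs A a x]%SET.
have DE : idx D = decomposition bs A a x.
  apply/fsetP => j; apply/imfsetP/idP => [[k /=]|jx]; first by rewrite inE => kD ->.
  have ij : (j <= i)%N.
    by rewrite leqNgt; apply/negP => /term_lt; have := imax _ jx; lia.
  have jM : (j < M)%N by apply: leq_ltn_trans ij _; exact: in_bin_bin_end iN.
  by exists (Ordinal jM); rewrite //= inE /= jx.
exists D; last by rewrite -sum_idx DE xE.
apply/block_familyP => n nN; rewrite -bin_count_idx DE; apply/andP; split => //.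
apply/implyP => /eqP ->; rewrite -DE bin_count_idx cards_eq0; apply/set0Pn.
by exists (Ordinal (in_bin_bin_end (leqnn N) iN)); rewrite !inE /= iD.
Qed.

Lemma largest_in_bin_perm :
  perm_eq (fset_set (largest_in_bin bs A a N))
    [seq terms_sum D | D <- enum legal_sets].
Proof.
(* Finiteness comes first, as [fset_set] is empty on infinite sets. *)
have fin : finite_set (largest_in_bin bs A a N).
  apply: (@sub_finite_set _ _ [set` [seq terms_sum D | D <- enum legal_sets]]).
    move=> x /largest_in_binE [D DL ->] /=.
    by apply/mapP; exists D => //; rewrite mem_enum.
  exact: finite_seq.
apply: uniq_perm; first exact: fset_uniq.
  rewrite map_inj_in_uniq ?enum_uniq // => D D'; rewrite !mem_enum.
  exact: terms_sum_inj.
move=> x; rewrite in_fset_set //.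
apply/idP/mapP => [/set_mem /largest_in_binE [D DL ->]|[D]].
  by exists D => //; rewrite mem_enum.
by rewrite mem_enum => DL ->; apply/mem_set/largest_in_binE; exists D.
Qed.

(** A single term of bin [N] is a legal set; this makes the denominators of the averages nonzero. *)
Lemma legal_sets_gt0 : (0 < #|legal_sets|)%N.
Proof.
have cN : #|bin_set bs N N| = bs N by rewrite card_bin_set // N_gt0 leqnn.
have /card_gt0P[i iN] : (0 < #|bin_set bs N N|)%N by rewrite cN bs_gt0.
rewrite inE in iN; apply/card_gt0P; exists [set i]%SET.
apply/block_familyP => n nN; rewrite /count_ok.
have [->|nN'] := eqVneq n N.
  have -> : [set i]%SET :&: bin_set bs N N = [set i]%SET.
    by apply/finset.setIidPl; rewrite finset.sub1set inE.
  by rewrite cards1 A_1.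
have -> : [set i]%SET :&: bin_set bs N n = finset.set0.
  apply/setP => j; rewrite !inE; apply/negP => /andP[/eqP -> jn].
  by move/eqP: nN'; apply; exact: in_bin_inj jn iN.
by rewrite cards0 A_0.
Qed.

Variable R : realType.

Lemma expectE (f : nat -> R) : expect bs A a N f =
  (\sum_(D in legal_sets) f (terms_sum D)) / #|legal_sets|%:R.
Proof.
rewrite /expect; congr (_ / _%:R).
  by rewrite (perm_big _ largest_in_bin_perm) big_map big_enum.
by rewrite (perm_size largest_in_bin_perm) size_map cardE.
Qed.

End Transfer.

Section BinomialBounds.

Lemma bin_le_exp B j : ('C(B, j) <= B ^ j)%N.
Proof.
elim: B j => [|B IH] [|j] //.
rewrite binS (leq_trans (leq_add (IH j.+1) (IH j))) // !expnS -mulSnr.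
by rewrite leq_mul //; case: j => // j; rewrite leq_exp2r.
Qed.

(** For [j < m <= B], the factor [B - j] of the falling factorial is at least [B / m]. *)
Lemma exp_le_bin m B k : (k <= m <= B)%N -> (B ^ k <= m ^ m * m`! * 'C(B, k))%N.
Proof.
move=> /andP[km mB].
have H j : (j <= m)%N -> (B ^ j <= m ^ j * B ^_ j)%N.
  elim: j => [|j IH] jm; first by rewrite ffactn0.
  have step : (B <= m * (B - j))%N.
    have -> : m = (m - j.+1 + j.+1)%N by lia.
    have : (0 <= (m - j.+1) * (B - j - 1))%N by [].
    nia.
  rewrite expnSr expnSr ffactnSr -mulnA [(m * _)%N]mulnCA mulnA.
  by rewrite leq_mul // IH // ltnW.
apply: (leq_trans (H _ km)); rewrite -bin_ffact [(_ * k`!)%N]mulnC mulnA.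
rewrite leq_mul2r; apply/orP; right; apply: leq_mul; last exact: leq_fact.
case: m {mB H} km => [|m] km; first by move: km; rewrite leqn0 => /eqP ->.
by rewrite leq_pexp2l.
Qed.

End BinomialBounds.

(** * Independence and boundedness of the counts *)

Section BinStatistics.
Variables (R : realType) (bs : nat -> nat) (A : {fset nat}) (a : nat -> nat).
Hypothesis bs_gt0 : forall n, (1 <= n)%N -> (0 < bs n)%N.
Hypothesis A_0 : 0%N \in A.
Hypothesis A_1 : 1%N \in A.
Hypothesis a_seq : bin_sequence bs A a.
Hypothesis a_uniq : unique_decompositions bs A a.
Local Notation Y := (Y bs A a).
Local Notation expect := (@expect bs A a R).
Local Notation mean := (@mean bs A a R).
Local Notation var := (@var bs A a R).
Local Notation stddev := (@stddev bs A a R).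
Local Notation m := (max_elt A).

Lemma Y_le_max n x : (Y n x <= m)%N.
Proof. by apply: leq_bigmax_seq => //; exact: Y_in_A. Qed.

Section FixedBin.
Variable N : nat.
Hypothesis N_gt0 : (1 <= N)%N.

Local Notation Omega := (fset_set (largest_in_bin bs A a N)).
Local Notation L := (legal_sets bs A N).

Lemma expect_avg (f : nat -> R) : expect N f = avg Omega f.
Proof. by []. Qed.

Lemma size_Omega : size Omega = #|L|.
Proof.
by rewrite (perm_size (largest_in_bin_perm A_0 A_1 a_seq a_uniq N_gt0)) size_map cardE.
Qed.

Lemma size_Omega_gt0 : (0 < size Omega)%N.
Proof. by rewrite size_Omega legal_sets_gt0. Qed.

(** A function of the counts in the other bins factors through the part of the legal set outside bin
    [n], so [block_family_indep] applies. *)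
Lemma expect_indep n (u : nat -> R) (v : nat -> R) : (n <= N)%N ->
  (forall x x', (forall k, k != n -> Y k x = Y k x') -> v x = v x') ->
  expect N (fun x => u (Y n x) * v x) = expect N (fun x => u (Y n x)) * expect N v.
Proof.
move=> nN vE; rewrite !(expectE A_0 A_1 a_seq a_uniq N_gt0).
have L0 : (0 < #|L|)%N by exact: legal_sets_gt0.
have /card_gt0P[D0 D0L] := L0.
have {L0} L0 : #|L|%:R != 0 :> R by rewrite pnatr_eq0 -lt0n.
pose B := bin_set bs N n.
pose ts := @terms_sum bs a N.
(* Refilling bin [n] with the trace of a fixed legal set [D0] restores legality and leaves the other
   counts unchanged. *)
pose v' S := v (ts (S :|: (D0 :&: B))).
have disj := @bin_set_disj bs N.
have vts D : D \in L -> v (ts D) = v' (D :\: B).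
  move=> DL; have sL : splice (bin_set bs N) n D D0 \in L.
    by apply: splice_family => //; move/block_familyP: D0L; apply.
  apply: vE => k kn; rewrite !(Y_terms_sum A_0 A_1 a_seq a_uniq N_gt0) //.
  by rewrite spliceI_neq // eq_sym.
have := block_family_indep (count_ok A N) disj (fun S => u #|S|) v' nN.
rewrite -/L => H.
have e1 : \sum_(D in L) u (Y n (ts D)) * v (ts D) =
   \sum_(D in L) u #|D :&: B| * v' (D :\: B).
  by apply: eq_bigr => D DL; rewrite vts // (Y_terms_sum A_0 A_1 a_seq a_uniq N_gt0).
have e2 : \sum_(D in L) u (Y n (ts D)) = \sum_(D in L) u #|D :&: B|.
  by apply: eq_bigr => D DL; rewrite (Y_terms_sum A_0 A_1 a_seq a_uniq N_gt0).
have e3 : \sum_(D in L) v (ts D) = \sum_(D in L) v' (D :\: B).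
  by apply: eq_bigr => D DL; rewrite vts.
rewrite e1 e2 e3 mulf_div -H mulrC.
by field.
Qed.

(** Induction on the bins of [J]: the event for one bin splits off by [expect_indep], since the
    remaining event depends on other bins only. *)
Lemma prob_indep : independent_counts bs A a R N.
Proof.
move=> J k JN; rewrite /prob.
have : {subset enum_fset J <= J} by [].
move: (fset_uniq J).
have -> : [set x | forall n, n \in J -> Y n x = k n] =
  [set x | forall n, n \in enum_fset J -> Y n x = k n] by [].
elim: (enum_fset J) => [|n s IH] /=.
  move=> _ _; rewrite big_nil.
  rewrite expect_avg -[RHS](avg_cst size_Omega_gt0); apply: eq_avg => x _.
  by rewrite indicE mem_set.
move=> /andP[ns us] sub; rewrite big_cons -IH //; last first.
  by move=> j js; apply: sub; rewrite inE js orbT.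
have /JN /andP[n1 nN] : n \in J by apply: sub; rewrite inE eqxx.
have indn x : \1_[set x | Y n x = k n] x = (Y n x == k n)%:R :> R.
  rewrite indicE; congr ((nat_of_bool _)%:R).
  by apply/idP/eqP => [/set_mem|e]; last exact/mem_set.
transitivity (expect N (fun x => (Y n x == k n)%:R *
    \1_[set x | forall n0, n0 \in s -> Y n0 x = k n0] x)).
  rewrite !expect_avg; apply: eq_avg => x _; rewrite -indn !indicE -natrM mulnb.
  congr ((nat_of_bool _)%:R).
  apply/idP/andP => [/set_mem /= H|[/set_mem /= H1 /set_mem /= H2]].
    split; apply/mem_set => /=; first by apply: H; rewrite inE eqxx.
    by move=> j js; apply: H; rewrite inE js orbT.
  by apply/mem_set => j; rewrite inE => /predU1P[->|/H2].
rewrite (expect_indep (fun y => (y == k n)%:R)) //.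
  by congr (_ * _); rewrite !expect_avg; apply: eq_avg => x _; rewrite indn.
move=> x x' xx'; rewrite !indicE; congr ((nat_of_bool _)%:R).
have sn j : j \in s -> j != n by move=> js; apply: contraNneq ns => <-.
by apply/idP/idP => /set_mem H; apply/mem_set => j js /=; rewrite -H // xx' // sn.
Qed.

Lemma mean_bounds n : 0 <= mean N n <= m%:R.
Proof.
rewrite /mean expect_avg; apply/andP; split.
  by apply: avg_ge0; [exact: size_Omega_gt0|move=> x _; exact: ler0n].
rewrite -[leRHS](avg_cst size_Omega_gt0); apply: le_avg; first exact: size_Omega_gt0.
by move=> x _; rewrite ler_nat Y_le_max.
Qed.

Lemma deviation_le n x : `|(Y n x)%:R - mean N n| <= m%:R.
Proof.
have /andP[m0 m1] := mean_bounds n.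
have y0 : 0 <= (Y n x)%:R :> R by exact: ler0n.
have y1 : (Y n x)%:R <= m%:R :> R by rewrite ler_nat Y_le_max.
by rewrite ler_norml; apply/andP; split; lra.
Qed.

Lemma var_ge0 n : 0 <= var N n.
Proof.
by apply: avg_ge0; [exact: size_Omega_gt0|move=> x _; exact: sqr_ge0].
Qed.

Lemma sum_var_ge0 : 0 <= \sum_(1 <= n < N.+1) var N n.
Proof. by apply: sumr_ge0 => n _; exact: var_ge0. Qed.

Lemma standardized_counts : 0 < stddev N ->
  standardized Omega (index_iota 1 N.+1)
    (fun n x => (stddev N)^-1 * ((Y n x)%:R - mean N n)) (m%:R / stddev N).
Proof.
move=> s0; have sN0 := lt0r_neq0 s0.
have O0 := size_Omega_gt0; split => //.
- by move=> n _; rewrite avgZ avgB (avg_cst O0) /mean expect_avg subrr mulr0.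
- move=> n nr f g V.
  have nN : (n <= N)%N by move: nr; rewrite mem_index_iota => /andP[].
  apply: (expect_indep (fun y => f ((stddev N)^-1 * (y%:R - mean N n))) nN).
  move=> x x' xx'; congr g; rewrite /V !(bigD1_seq n) ?iota_uniq //=.
  rewrite [X in X - _]addrC addrK [X in _ = X - _]addrC addrK.
  apply: eq_bigr => k kn.
  by rewrite (xx' _ kn).
- move=> n x _ _; rewrite normrM ger0_norm ?invr_ge0 ?(ltW s0) // mulrC.
  by rewrite ler_pM2r ?invr_gt0 // deviation_le.
- have -> : \sum_(n <- index_iota 1 N.+1)
      avg Omega (fun x => ((stddev N)^-1 * ((Y n x)%:R - mean N n)) ^+ 2) =
    (stddev N) ^- 2 * \sum_(1 <= n < N.+1) var N n.
    rewrite big_distrr /=; apply: eq_bigr => n _; rewrite /var expect_avg -avgZ.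
    by apply: eq_avg => x _; rewrite exprMn exprVn.
  rewrite /stddev sqr_sqrtr ?sum_var_ge0 // mulVf //.
  by move: s0; rewrite /stddev sqrtr_gt0 => /lt0r_neq0.
Qed.

End FixedBin.

End BinStatistics.

Section MaxElt.
Variable A : {fset nat}.

Lemma leq_max_elt k : k \in A -> (k <= max_elt A)%N.
Proof. by move=> kA; apply: leq_bigmax_seq. Qed.

Lemma max_elt_in k : k \in A -> max_elt A \in A.
Proof.
rewrite /max_elt; have : {subset enum_fset A <= A} by [].
have : k \in A -> k \in enum_fset A by [].
move=> H sub /H {H}; move: sub k; elim: (enum_fset A) => //= j s IH sub k.
have jA : j \in A by apply: sub; rewrite inE eqxx.
have sA : {subset s <= A} by move=> i si; apply: sub; rewrite inE si orbT.
case: s IH sA {sub} => [|i s] IH sA _; first by rewrite big_cons big_nil maxn0.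
rewrite big_cons; case: (leqP j (\max_(l <- i :: s) l)%N) => _ //.
by apply: (IH sA i); rewrite inE eqxx.
Qed.

End MaxElt.

(** Since 1 is in [A], the maximum is positive, and 0 survives its removal. *)
Lemma second_max_in (A : {fset nat}) : 0%N \in A -> 1%N \in A ->
  max_elt (A `\ max_elt A) \in A `\ max_elt A.
Proof.
move=> A0 A1; apply: (@max_elt_in _ 0%N); rewrite !inE A0 andbT.
by have := leq_max_elt A1; case: (max_elt A).
Qed.

(** * Lower bound for the variance of one count *)

Section VarianceBound.
Variables (R : realType) (bs : nat -> nat) (A : {fset nat}) (a : nat -> nat).
Hypothesis bs_gt0 : forall n, (1 <= n)%N -> (0 < bs n)%N.
Hypothesis A_0 : 0%N \in A.
Hypothesis A_1 : 1%N \in A.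
Hypothesis a_seq : bin_sequence bs A a.
Hypothesis a_uniq : unique_decompositions bs A a.
Hypothesis A_bs : forall n, (1 <= n)%N -> (max_elt A <= bs n)%N.
Local Notation Y := (Y bs A a).
Local Notation mean := (@mean bs A a R).
Local Notation var := (@var bs A a R).
Local Notation stddev := (@stddev bs A a R).
Local Notation m := (max_elt A).
Local Notation m' := (max_elt (A `\ m)).

(* The binomial estimates [bin_le_exp] and [exp_le_bin] show that, up to this
   factor, [Y_n = k] has probability at least [b_n ^ k / b_n ^ m]. *)
Definition bin_const : nat := (#|` A| * (m ^ m * m`!))%N.

Lemma bin_const_gt0 : (0 < bin_const)%N.
Proof.
rewrite /bin_const !muln_gt0 fact_gt0 expn_gt0 (leq_max_elt A_1) /= andbT.
by rewrite cardfs_gt0; apply/fset0Pn; exists 0%N.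
Qed.

Section FixedBins.
Variables N n : nat.
Hypothesis n_gt0 : (1 <= n)%N.
Hypothesis nN : (n < N)%N.
Local Notation L := (legal_sets bs A N).
Local Notation B := (bin_set bs N n).

Definition count_of k := #|[set D in L | #|D :&: B| == k]%SET|.

Lemma count_of_ge k : k \in A ->
  (#|L| * bs n ^ k <= bin_const * bs n ^ m * count_of k)%N.
Proof.
move=> kA.
have cB : #|B| = bs n by rewrite card_bin_set // n_gt0 ltnW.
have ok j : j \in A -> count_ok A N n j by move=> jA; rewrite /count_ok jA (ltn_eqF nN).
pose q := #|free_family N (bin_set bs N) (count_ok A N) n|.
have cnt j : j \in A -> count_of j = (q * 'C(bs n, j))%N.
  move=> jA; rewrite /count_of (card_trace_size (@bin_set_disj bs N)) ?cB //.
  - exact: ltnW.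
  - exact: ok.
  - exact: ok.
(* Every legal set has its count in [A], and each value in [A] is taken by at most [q * bs n ^ m]
   legal sets. *)
have total : (#|L| <= q * (#|` A| * bs n ^ m))%N.
  apply: (@leq_trans (\sum_(j <- A) count_of j)).
    rewrite -sum1_card /count_of.
    under [leqRHS]eq_bigr do rewrite -sum1dep_card big_mkcondr.
    rewrite exchange_big /=; apply: leq_sum => D DL.
    have DA : #|D :&: B| \in A.
      by move: DL => /block_familyP /(_ n (ltnW nN)) /andP[].
    by rewrite (bigD1_seq #|D :&: B|) ?fset_uniq //= eqxx leq_addr.
  rewrite [X in (X <= _)%N]big_seq.
  apply: (@leq_trans (\sum_(j <- A | j \in A) q * bs n ^ m)).
    apply: leq_sum => j jA; rewrite cnt // leq_mul // (leq_trans (bin_le_exp _ _)) //.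
    by rewrite leq_pexp2l ?bs_gt0 // leq_max_elt.
  rewrite -big_seq big_const_seq count_predT iter_addn_0.
  by rewrite -mulnA leq_mul2l [(bs n ^ m * _)%N]mulnC leqnn orbT.
rewrite cnt //; have lo := @exp_le_bin m (bs n) k.
rewrite leq_max_elt // A_bs // in lo; have {}lo := lo isT.
apply: (leq_trans (leq_mul total lo)); rewrite /bin_const.
by rewrite [X in (X <= _)%N](_ : _ =
  (#|` A| * (m ^ m * m`!) * bs n ^ m * (q * 'C(bs n, k)))%N) //; ring.
Qed.

(** The values [m] and [m'] each have probability at least [1 / Z], where [Z] is [bin_const] times
    [bs n ^ (m - m')]. They differ by at least 1, so their squared distances to the mean add up to
    at least 1/2. *)
Lemma var_ge : (2 * bin_const%:R * (bs n)%:R ^+ (m - m'))^-1 <= var N n.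
Proof.
have N0 : (1 <= N)%N by exact: leq_ltn_trans nN.
have mA := max_elt_in A_0.
have := second_max_in A_0 A_1; rewrite !inE => /andP[m'm m'A].
have lt : (m' < m)%N by rewrite ltn_neqAle m'm leq_max_elt.
have L0 : (0 < #|L|)%N by exact: legal_sets_gt0.
have L0R : 0 < #|L|%:R :> R by rewrite ltr0n.
have B0 := bs_gt0 n_gt0.
have key k : k \in A -> (m' <= k)%N ->
   #|L|%:R <= bin_const%:R * (bs n)%:R ^+ (m - m') * (count_of k)%:R :> R.
  move=> kA m'k; rewrite -natrX -!natrM ler_nat.
  rewrite -(@leq_pmul2r (bs n ^ m')) ?expn_gt0 ?B0 //.
  apply: (leq_trans (leq_mul (leqnn _) (leq_pexp2l B0 m'k))).
  apply: (leq_trans (count_of_ge kA)).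
  rewrite -{1}(subnK (ltnW lt)) expnD -!mulnA leq_mul2l.
  by rewrite [(_ ^ m' * _)%N]mulnC leqnn orbT.
have B0R : 0 < bin_const%:R * (bs n)%:R ^+ (m - m') :> R.
  by rewrite mulr_gt0 ?exprn_gt0 ?ltr0n // bin_const_gt0.
set Z : R := bin_const%:R * (bs n)%:R ^+ (m - m') in B0R key *.
rewrite /var (expectE A_0 A_1 a_seq a_uniq N0) -mulrA -/Z.
set mu := mean N n.
have : (count_of m)%:R * (m%:R - mu) ^+ 2 + (count_of m')%:R * (m'%:R - mu) ^+ 2 <=
   \sum_(D in L) ((Y n (terms_sum a D))%:R - mu) ^+ 2.
  have cE k c : (count_of k)%:R * c = \sum_(D in L) (#|D :&: B| == k)%:R * c :> R.
    rewrite -big_distrl /= -natr_sum /count_of -sum1dep_card big_mkcondr.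
    by congr (_%:R * _); apply: eq_bigr => D _; case: eqP.
  rewrite !cE -big_split /=; apply: ler_sum => D DL.
  rewrite (Y_terms_sum A_0 A_1 a_seq a_uniq N0) //.
  have [->|_] := eqVneq #|D :&: B| m.
    by rewrite eq_sym (negPf m'm) mul1r mul0r addr0.
  have [->|_] := eqVneq #|D :&: B| m'; first by rewrite mul1r mul0r add0r.
  by rewrite !mul0r addr0 sqr_ge0.
rewrite ler_pdivlMr // => /(le_trans _); apply.
have kL k : k \in A -> (m' <= k)%N -> #|L|%:R / Z <= (count_of k)%:R :> R.
  by move=> kA m'k; rewrite ler_pdivrMr // mulrC key.
apply: (@le_trans _ _ (#|L|%:R / Z * (m%:R - mu) ^+ 2 +
    #|L|%:R / Z * (m'%:R - mu) ^+ 2)); last first.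
  by apply: lerD; apply: ler_wpM2r; rewrite ?sqr_ge0 // kL // ltnW.
rewrite -mulrDr; have -> : (2 * Z)^-1 * #|L|%:R = #|L|%:R / Z * 2^-1.
  by field; rewrite gt_eqF.
have {key kL} : 0 <= #|L|%:R / Z by rewrite divr_ge0 // ltW.
move=> q0; rewrite ler_wpM2l //.
have gap : 1 <= m%:R - m'%:R :> R by rewrite -natrB ?ler1n ?subn_gt0 // ltnW.
have : 1 <= (m%:R - m'%:R) ^+ 2 :> R by rewrite exprn_ege1.
(* Parallelogram identity: twice the sum of two squares is the square of the difference plus the
   square of the sum. *)
have := sqr_ge0 ((m%:R - mu) + (m'%:R - mu)).
by rewrite !expr2; lra.
Qed.

End FixedBins.

End VarianceBound.

Lemma harmonic_tail_large (R : realType) (n0 : nat) (C : R) :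
  \forall N \near \oo, C <= \sum_(n0.+1 <= n < N) n%:R^-1.
Proof.
have incr : {homo series (@harmonic R) : n k / (n <= k)%N >-> n <= k}.
  by apply: nondecreasing_series => n _ _; rewrite /= invr_ge0.
have /cvgryPge /(_ (C + series harmonic n0)) [K _ KP] :=
  nondecreasing_dvgn_lt incr (@dvg_harmonic R).
exists (K + n0).+1 => // -[|N] //= KN.
(* The shift matches [harmonic], whose term of index [n] is the inverse of [n.+1]. *)
rewrite -addn1 big_addn subn1 /=.
have KN' : (K <= N)%N by lia.
have := KP N KN'; rewrite /series /= (@big_cat_nat _ _ _ n0 0 N) //=; last by lia.
rewrite addrC lerD2r => /le_trans; apply; rewrite le_eqVlt; apply/orP; left.
by apply/eqP; apply: eq_bigr => i _; rewrite addn1.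
Qed.

(** * Divergence of the total variance and the limit theorems *)

Section Growth.
Variables (R : realType) (bs : nat -> nat) (A : {fset nat}) (a : nat -> nat).
Hypothesis bs_gt0 : forall n, (1 <= n)%N -> (0 < bs n)%N.
Hypothesis A_0 : 0%N \in A.
Hypothesis A_1 : 1%N \in A.
Hypothesis a_seq : bin_sequence bs A a.
Hypothesis a_uniq : unique_decompositions bs A a.
Hypothesis A_bs : forall n, (1 <= n)%N -> (max_elt A <= bs n)%N.
Local Notation Y := (Y bs A a).
Local Notation mean := (@mean bs A a R).
Local Notation var := (@var bs A a R).
Local Notation stddev := (@stddev bs A a R).
Local Notation m := (max_elt A).
Local Notation m' := (max_elt (A `\ m)).
Hypothesis growth : \forall n \near \oo, (bs n ^ (m - m') <= n)%N.

Lemma sum_var_large (C : R) :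
  \forall N \near \oo, C <= \sum_(1 <= n < N.+1) var N n.
Proof.
have [n0 _ n0P] := growth.
have K0 : 0 < 2 * (bin_const A)%:R :> R.
  by rewrite mulr_gt0 // ltr0n bin_const_gt0.
near=> N.
have Nn0 : (n0.+1 <= N)%N by near: N; exists n0.+1.
have N0 : (1 <= N)%N by lia.
have HN : C * (2 * (bin_const A)%:R) <= \sum_(n0.+1 <= n < N) n%:R^-1.
  by near: N; exact: harmonic_tail_large.
(* The first [n0] bins, and bin [N] to which [var_ge] does not apply, are bounded below by 0. *)
rewrite (@big_cat_nat _ _ _ n0.+1) //=; last by lia.
rewrite [X in _ + X]big_nat_recr //= addrA.
have v0 k : 0 <= var N k by apply: var_ge0.
rewrite -[C]addr0 -[C]add0r lerD // lerD //; first by apply: sumr_ge0.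
rewrite -(ler_pM2r K0); apply: (le_trans HN); rewrite big_distrl /=.
rewrite big_nat [leRHS]big_nat; apply: ler_sum => n /andP[n1 n2].
have ngt0 : (1 <= n)%N by lia.
rewrite -ler_pdivrMr //.
apply: le_trans (var_ge R bs_gt0 A_0 A_1 a_seq a_uniq A_bs ngt0 n2).
rewrite -invfM lef_pV2 ?posrE.
- rewrite [leRHS]mulrC ler_pM2l // -natrX ler_nat; apply: n0P => /=; lia.
- by rewrite mulr_gt0 // ltr0n.
- by rewrite mulr_gt0 // exprn_gt0 // ltr0n bs_gt0.
Unshelve. all: by end_near. Qed.

Lemma stddev_cvgy : stddev N @[N --> \oo] --> +oo.
Proof.
apply/cvgryPge => C; near=> N.
have : C ^+ 2 <= \sum_(1 <= n < N.+1) var N n by near: N; exact: sum_var_large.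
move=> /ler_wsqrtr; rewrite sqrtr_sqr; exact/le_trans/ler_norm.
Unshelve. all: by end_near. Qed.

Let ratio_cvg0 : m%:R / stddev N @[N --> \oo] --> (0 : R).
Proof.
rewrite -[X in _ --> X](mulr0 m%:R); apply: cvgM; first exact: cvg_cst.
apply/gtr0_cvgV0; last exact: stddev_cvgy.
by move/cvgryPgt : stddev_cvgy; apply.
Qed.

Let stddev_pos : \forall N \near \oo, (1 <= N)%N /\ 0 < stddev N.
Proof.
near=> N; split; first by near: N; exists 1%N.
by near: N; move/cvgryPgt : stddev_cvgy; apply.
Unshelve. all: by end_near. Qed.

(** Deviations are at most [m], so a third absolute moment is at most [m] times the variance, and
    the Lyapunov ratio is at most [m / stddev N]. *)
Lemma lyapunov_holds : lyapunov_condition bs A a R.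
Proof.
exists 1 => //.
apply: (@squeeze_cvgr _ _ _ _ (fun=> 0) (fun N => m%:R / stddev N)) => //;
  last exact: cvg_cst.
near=> N.
have [N0 s0] : (1 <= N)%N /\ 0 < stddev N by near: N.
have pow3 (x : R) : 0 <= x -> x `^ (2 + 1) = x ^+ 3.
  by move=> x0; rewrite natr1 powR_mulrn.
have s3 : 0 < stddev N `^ (2 + 1) by exact: powR_gt0.
apply/andP; split.
  rewrite divr_ge0 ?(ltW s3) // sumr_ge0 // => n _.
  by apply: avg_ge0; [exact: size_Omega_gt0|move=> x _; exact: powR_ge0].
rewrite ler_pdivrMr // pow3 ?(ltW s0) //.
have -> : m%:R / stddev N * stddev N ^+ 3 = m%:R * stddev N ^+ 2.
  by field; rewrite gt_eqF.
rewrite /stddev sqr_sqrtr ?sum_var_ge0 // big_distrr /=.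
apply: ler_sum => n _; rewrite /var !expect_avg -avgZ; apply: le_avg.
  exact: size_Omega_gt0.
move=> x _; rewrite pow3 // exprS -normrX [X in _ * X]ger0_norm ?sqr_ge0 //.
by rewrite ler_wpM2r ?sqr_ge0 // deviation_le.
Unshelve. all: by end_near. Qed.

Lemma normalized_sum_cvg : converges_to_std_normal bs A a R.
Proof.
move=> t; rewrite -EFin_normal_cdf; apply: cvg_EFin; first by near=> N.
have std : \forall N \near \oo, standardized (fset_set (largest_in_bin bs A a N))
    (index_iota 1 N.+1)
    (fun n x => (stddev N)^-1 * ((Y n x)%:R - mean N n)) (m%:R / stddev N).
  near=> N; have [N0 s0] : (1 <= N)%N /\ 0 < stddev N by near: N.
  exact: standardized_counts.
have := @clt_standardized R _ _ _ _ _ std ratio_cvg0 t.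
apply: cvg_trans; apply: near_eq_cvg; near=> N => /=.
rewrite /prob expect_avg; apply: eq_avg => x _.
rewrite indicE /normalized_sum -big_distrr /=; congr ((nat_of_bool _)%:R).
by apply/idP/idP => [|/set_mem //]; exact: mem_set.
Unshelve. all: by end_near. Qed.

End Growth.

(** Take the constant 1 in the little-o and raise both sides to the power [d]. *)
Lemma littleo_root_growth (R : realType) (b : nat -> nat) (d : nat) : (0 < d)%N ->
  (fun n : nat => (b n)%:R : R^o) =o_\oo
    (fun n : nat => (n%:R : R) `^ d%:R^-1 : R^o) ->
  \forall n \near \oo, (b n ^ d <= n)%N.
Proof.
move=> d0 /eqoP /(_ 1 ltr01); apply: filterS => n.
rewrite mul1r !ger0_norm ?powR_ge0 // => H.
rewrite -(ler_nat R) natrX.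
have := lerXn2r d _ _ H; rewrite !nnegrE powR_ge0 ler0n => /(_ isT isT).
rewrite -[X in _ <= X]powR_mulrn ?powR_ge0 // -powRrM.
by rewrite mulVf ?pnatr_eq0 -?lt0n // powRr1.
Qed.

Theorem theorem1p3 (R : realType) (bs : nat -> nat) (b : nat) (A : {fset nat})
    (a : nat -> nat)
    (bs_gt0 : forall n, (1 <= n)%N -> (0 < bs n)%N)
    (A_0 : 0%N \in A) (A_1 : 1%N \in A)
    (A_le : forall k, k \in A -> (k <= b)%N)
    (b_le : forall n, (1 <= n)%N -> (b <= bs n)%N)
    (a_seq : bin_sequence bs A a)
    (a_uniq : unique_decompositions bs A a)
    (growth : let m := max_elt A in
              let m' := max_elt (A `\ m) in
              (fun n : nat => (bs n)%:R : R^o) =o_\oo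
              (fun n : nat => (n%:R : R) `^ ((m - m')%N%:R)^-1 : R^o)) :
  lyapunov_gaussian bs A a R.
Proof.
have A_bs n : (1 <= n)%N -> (max_elt A <= bs n)%N.
  by move=> /b_le; apply: leq_trans; apply: A_le; exact: max_elt_in A_0.
have gap : (0 < max_elt A - max_elt (A `\ max_elt A))%N.
  have := second_max_in A_0 A_1; rewrite !inE => /andP[neq inA].
  by rewrite subn_gt0 ltn_neqAle neq leq_max_elt.
have {}growth := littleo_root_growth gap growth.
split; first by move=> N N0; exact: prob_indep.
  exact: lyapunov_holds.
exact: normalized_sum_cvg.
Qed.
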